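(* Let $D$ be a connected locally semicomplete digraph on $n\ge 3$ vertices, and let $C_1,C_2,\dots,C_\ell$ be the acyclic ordering of the strong components of $D$. Let $\sigma^{hc}_{\max}=0$ if $D$ has no Hamilton oriented cycle, and otherwise let $\sigma^{hc}_{\max}$ be the maximum of $\sigma^+(R)$ over all Hamilton oriented cycles $R$ in $D$. Then: (i) if $D$ is not strong and $U(D)$ is 2-connected, then $\sigma^{hc}_{\max}=n-d(C_1,C_\ell)$; (ii) if $D$ is not strong and $U(D)$ is not 2-connected, then $\sigma^{hc}_{\max}=0$; (iii) if $D$ is strong, then $\sigma^{hc}_{\max}=n$. Furthermore, if $D$ has a Hamilton oriented cycle, a Hamilton oriented cycle of $D$ with the maximum number of forward arcs can be found in time polynomial in the size of $D$.
   Context: For $x\in V(D)$, $N^+(x)=\{y: xy\in A(D)\}$ and $N^-(x)=\{y: yx\in A(D)\}$. A semicomplete digraph is obtained from a complete graph by replacing each edge $\{x,y\}$ by the arc $xy$, the arc $yx$, or both. $D$ is locally semicomplete if for every $x\in V(D)$ both $D[N^+(x)]$ and $D[N^-(x)]$ are semicomplete. $U(D)$ is the underlying undirected (multi)graph of $D$; $D$ is connected if $U(D)$ is connected, and strong if for every ordered pair $x,y$ there is a directed path from $x$ to $y$. Strong components are maximal strong subdigraphs; an acyclic ordering $C_1,\dots,C_\ell$ of them is one with no arc from $C_j$ to $C_i$ for $i<j$ (for a connected locally semicomplete digraph this ordering is unique). For vertex-disjoint subgraphs $S,T$, an $(S,T)$-path is a directed path $p_1\dots p_t$ with $p_1\in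 V(S)$, $p_t\in V(T)$ and all other vertices outside $S\cup T$; $d(S,T)$ is the length (number of arcs) of a shortest $(S,T)$-path. An oriented cycle $R=v_1\dots v_mv_1$ in $D$ is a cyclic sequence of distinct vertices with consecutive ones (indices mod $m$) adjacent in $D$; it is Hamilton if it contains all vertices. The pair $v_i,v_{i+1}$ is a forward arc if $v_iv_{i+1}\in A(D)$ and backward otherwise; $\sigma^+(R)$ is the number of forward arcs. *)

(* Defs.v *)
From mathcomp Require Import all_boot all_order all_algebra.

Set Implicit Arguments.
Unset Strict Implicit.
Unset Printing Implicit Defensive.

(* Loopless; [arc x y] and [arc y x] may both hold. *)
Record digraph := Digraph {
  vert :> finType;
  arc : rel vert;
  arc_irr : irreflexive arc }.

Section Digraphs.
Variable D : digraph.
Implicit Types (x y : D) (X Y S T : {set D}) (R : seq D).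

Definition outN x : {set D} := [set y | arc x y].
Definition inN x : {set D} := [set y | arc y x].

Definition semicomplete_on X : bool :=
  [forall x in X, forall y in X, (x != y) ==> (arc x y || arc y x)].

Definition locally_semicomplete : bool :=
  [forall x : D, semicomplete_on (outN x) && semicomplete_on (inN x)].

(* Adjacency in U(D). Edge multiplicities are dropped: they affect neither
   connectedness nor 2-connectedness, which here is vertex connectivity. *)
Definition adj : rel D := [rel x y | arc x y || arc y x].

Definition induced (e : rel D) X : rel D :=
  [rel x y | [&& x \in X, y \in X & e x y]].

Definition all_connected (e : rel D) X : bool :=
  [forall x in X, forall y in X, connect (induced e X) x y].

Definition connected : bool := all_connected adj [set: D].

Definition two_connected : bool :=
  [&& 2 < #|D|, connected & [forall v : D, all_connected adj [set~ v]]].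

Definition strong_on X : bool := all_connected (@arc D) X.

Definition strong : bool := strong_on [set: D].

(* Maximal strong subdigraphs are induced, hence given by vertex sets. *)
Definition strong_component X : bool := maxset strong_on X.

Definition no_arc_from_to Y X : bool :=
  [forall y in Y, forall x in X, ~~ arc y x].

Definition acyclic_ordering (Cs : seq {set D}) : Prop :=
  [/\ uniq Cs, Cs =i strong_component
    & pairwise (fun Ci Cj => no_arc_from_to Cj Ci) Cs].

(* The directed path with vertices x :: p; it has [size p] arcs, and
   [behead (belast x p)] is the sequence of its internal vertices. *)
Definition ST_path S T x (p : seq D) : bool :=
  [&& path (@arc D) x p, uniq (x :: p), x \in S, last x p \in T
    & all [pred y | y \notin S :|: T] (behead (belast x p))].

(* d(S,T) = d; false for every d when there is no (S,T)-path. *)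
Definition is_dist S T (d : nat) : Prop :=
  (exists x p, ST_path S T x p /\ size p = d) /\
  (forall x p, ST_path S T x p -> d <= size p).

Definition oriented_cycle R : bool := ucycleb adj R.

Definition hamilton_oriented_cycle R : bool :=
  oriented_cycle R && [forall x : D, x \in R].

Definition sigma_plus R : nat := count (fun x => arc x (next R x)) R.

(* A Hamilton oriented cycle visits each vertex exactly once, hence is a
   #|D|-tuple; a maximum over the empty range is 0. *)
Definition sigma_hc_max : nat :=
  \max_(R : #|D|.-tuple D | hamilton_oriented_cycle R) sigma_plus R.

Definition dsize : nat := #|D| + #|[set a : D * D | arc a.1 a.2]|.

End Digraphs.

(* Model of computation: first-order recursive functional programs over binary
   trees (pure Lisp), call by value.  A program is a list of function bodies,
   each with a single parameter, and the running time is the number of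
   evaluation steps.  The size of the environment is bounded by a constant
   depending only on the program, and all values can be represented by shared
   pointers, so this model and Turing machines simulate each other with
   polynomial overhead. *)
Inductive tree := Leaf | Node of tree & tree.

(* Variables are de Bruijn indices. [ECase e e0 e1] evaluates e0 if the value
   of e is [Leaf], and e1, with l as variable 0 and r as variable 1 in front of
   the environment, if it is [Node l r]. *)
Inductive expr :=
  | EVar of nat
  | ELeaf
  | ENode of expr & expr
  | ECase of expr & expr & expr
  | ELet of expr & expr
  | ECall of nat & expr.

Definition program := seq expr.

(* [eval p env e v t]: in the environment [env], [e] evaluates to [v] in [t]
   steps. *)
Inductive eval (p : program) : seq tree -> expr -> tree -> nat -> Prop :=
  | eval_var env i : eval p env (EVar i) (nth Leaf env i) 1
  | eval_leaf env : eval p env ELeaf Leaf 1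
  | eval_node env e1 e2 v1 v2 t1 t2 :
      eval p env e1 v1 t1 -> eval p env e2 v2 t2 ->
      eval p env (ENode e1 e2) (Node v1 v2) (t1 + t2).+1
  | eval_case_leaf env e e0 e1 v t t' :
      eval p env e Leaf t -> eval p env e0 v t' ->
      eval p env (ECase e e0 e1) v (t + t').+1
  | eval_case_node env e e0 e1 l r v t t' :
      eval p env e (Node l r) t -> eval p [:: l, r & env] e1 v t' ->
      eval p env (ECase e e0 e1) v (t + t').+1
  | eval_let env e1 e2 u v t t' :
      eval p env e1 u t -> eval p (u :: env) e2 v t' ->
      eval p env (ELet e1 e2) v (t + t').+1
  | eval_call env f e u v t t' :
      eval p env e u t -> eval p [:: u] (nth ELeaf p f) v t' ->
      eval p env (ECall f e) v (t + t').+1.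

Definition runs (p : program) (input output : tree) (t : nat) : Prop :=
  eval p [:: input] (ECall 0 (EVar 0)) output t.

Definition enc_seq A (enc : A -> tree) (s : seq A) : tree :=
  foldr (fun a => Node (enc a)) Leaf s.

Definition enc_bool (b : bool) : tree := if b then Node Leaf Leaf else Leaf.

Definition enc_nat (n : nat) : tree := iter n (Node Leaf) Leaf.

(* The adjacency matrix, a list of rows, in the order of [enum D]. *)
Definition enc_digraph (D : digraph) : tree :=
  enc_seq (fun x => enc_seq (fun y => enc_bool (arc x y)) (enum D)) (enum D).

(* Vertices are named by their position in [enum D], in unary. *)
Definition enc_vertices (D : digraph) (R : seq D) : tree :=
  enc_seq (fun x => enc_nat (enum_rank x)) R.

(* Main.v *)
Require Import Defs.
From mathcomp Require Import all_boot all_order all_algebra.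
From mathcomp Require Import zify.

(* If w -> y, x reaches y and x does not reach w, then w -> x: walk back along a
   path from x to y.  So in a connected locally semicomplete digraph arcs between
   different strong components depend on the components only, and reachability is
   a total preorder.

   Upper bound: let p_0, ..., p_d be the greedy path from s in C_1 to z in C_l, each
   p_(i+1) being an out-neighbour of p_i in the last possible component, and let the
   level of v be the number of p_i, i < d, not reachable from v.  An arc never decreases the
   level and raises it by at most 1, so a walk in U(D) from C_l (level d) to C_1
   (level 0) uses at least d backward arcs, and a path from C_1 to C_l has at
   least d arcs.

   Construction: keep a sequence w of vertices and, as long as possible, splice
   into it a path through unvisited vertices between two consecutive elements of
   w.  Starting from [x, x], this can only stop at a directed Hamilton cycle if D
   is strong.  Otherwise start from [s, z] and forbid p_1, ..., p_(d-1): if U(D) is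
   2-connected, this can only stop at a directed path from s to z through all
   other vertices, which the greedy path, traversed backwards, closes to a
   Hamilton oriented cycle with exactly d backward arcs.  Taking the greedy path
   among the shortest paths is essential: for other shortest paths, the vertices
   outside the path need not contain a path from s to z. *)

Set Implicit Arguments.
Unset Strict Implicit.
Unset Printing Implicit Defensive.

(** * Reachability in locally semicomplete digraphs *)

Section Splitting.
Variable T : eqType.
Implicit Types (x y v : T) (q w : seq T).

Lemma split_change (P : pred T) x q :
  P x -> ~~ P (last x q) ->
  exists w1 a b w2, [/\ x :: q = w1 ++ a :: b :: w2, P a & ~~ P b].
Proof.
elim: q x => [|y q IH] x Px; first by rewrite /= Px.
case Py: (P y) => nPl; last by exists [::], x, y, q; rewrite Py.
have [w1 [a [b [w2 [-> Pa Pb]]]]] := IH y Py nPl.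
by exists (x :: w1), a, b, w2.
Qed.

Lemma mem_split x q : x \in q -> exists l1 l2, q = l1 ++ x :: l2.
Proof. by case/splitPr => l1 l2; exists l1, l2. Qed.

(** [behead] strips the start [x], which heads [rcons w1 a]; this treats an empty and a nonempty
    [w1] alike. *)
Lemma path_split (e : rel T) x q w1 a b w2 :
  path e x q -> x :: q = w1 ++ a :: b :: w2 ->
  [/\ path e x (rcons (behead (rcons w1 a)) b), e a b & path e b w2].
Proof.
move=> + E; case: w1 E => [|x' w1] [-> ->] /=; first by case/andP=> -> ->.
by rewrite cat_path /= !rcons_path !last_rcons => /and4P[-> -> -> ->].
Qed.

(** No arc from [a] to [b] is required, so that the notion also applies to the starting pairs
    [[:: x; x]] and [[:: s; z]], which need not be paths. *)
Definition insertable (e : rel T) w v : Prop :=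
  exists w1 a b w2, [/\ w = w1 ++ a :: b :: w2, e a v & e v b].

Lemma insertable_cat e w0 w v w3 : insertable e w v -> insertable e (w0 ++ w ++ w3) v.
Proof.
by case=> w1 [a [b [w2 [-> av vb]]]]; exists (w0 ++ w1), a, b, (w2 ++ w3); rewrite -!catA.
Qed.

Lemma insertable_cons e x w v : insertable e w v -> insertable e (x :: w) v.
Proof. by move=> h; have := insertable_cat [:: x] [::] h; rewrite cats0. Qed.

Lemma insertable_rev (e : rel T) w v :
  insertable [rel x y | e y x] (rev w) v -> insertable e w v.
Proof.
case=> w1 [a [b [w2 [/(congr1 rev)]]]]; rewrite revK rev_cat !rev_cons -!cats1 -!catA /=.
by move=> -> av vb; exists (rev w2), b, a, (rev w1).
Qed.

(** One half of local semicompleteness. The other half is the same property of the converse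
    relation, so arguments about out-neighbours transfer to in-neighbours. *)
Definition out_semicomplete (e : rel T) :=
  forall x y z, e x y -> e x z -> y != z -> e y z || e z y.

(** The arc into [v] slides along the path: if [v] does not dominate the next vertex, that vertex
    is, like [v], an out-neighbour of the current one and hence dominates [v]. At the latest just
    before [b], the vertex [v] fits in. *)
Lemma slide (e : rel T) x q v b : out_semicomplete e ->
  path e x q -> e x v -> v \notin q -> b \in q -> e v b -> insertable e (x :: q) v.
Proof.
move=> osc; elim: q x => [//|y q IH] x /= /andP[xy yq] xv.
rewrite !inE negb_or => /andP[nvy nvq] bq vb.
case vy: (e v y); first by exists [::], x, y, q.
apply: insertable_cons; apply: IH => //.
  by have := osc _ _ _ xv xy nvy; rewrite vy.
by case/orP: bq => // /eqP bE; rewrite -bE vb in vy.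
Qed.

(** The same sliding; as [v] never fits in, the arc passes through every vertex of the path. *)
Lemma slide_all (e : rel T) x q v : out_semicomplete e ->
  path e x q -> e x v -> v \notin q -> ~ insertable e (x :: q) v ->
  forall c, c \in x :: q -> e c v.
Proof.
move=> osc pq xv nvq nins c; rewrite inE => /predU1P[-> //|cq].
case: (splitPr cq) pq nvq nins => q1 q2; rewrite cat_path /= => /and3P[p1 lc p2].
rewrite mem_cat inE !negb_or => /and3P[nv1 nvc nv2] nins {cq}.
elim: q1 x xv p1 lc nv1 nins => [|y q1 IH] x xv /=.
  move=> _ xc _ nins; have := osc _ _ _ xv xc nvc; case: (boolP (e v c)) => // vc _.
  by case: nins; exists [::], x, c, q2.
case/andP=> xy yq1 lc; rewrite inE negb_or => /andP[nvy nv1] nins.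
apply: (IH y) => //; last by move=> h; apply: nins; apply: insertable_cons.
have := osc _ _ _ xv xy nvy; case: (boolP (e v y)) => // vy _.
by case: nins; exists [::], x, y, (q1 ++ c :: q2).
Qed.

End Splitting.

Section Reachability.
Variables (T : finType) (e : rel T).
Let e' := [rel x y | e y x].

Lemma connect_conv x y : connect e' x y = connect e y x.
Proof. exact: (connect_rev e). Qed.

Lemma connect_cross (P : pred T) x y : P x -> ~~ P y -> connect e x y ->
  exists a b, [/\ P a, ~~ P b, e a b, connect e x a & connect e b y].
Proof.
move=> Px nPy /connectP[p ep yE]; rewrite yE in nPy.
have [w1 [a [b [w2 [E Pa Pb]]]]] := split_change Px nPy.
have [p1 ab p2] := path_split ep E; exists a, b; split=> //.
  apply: (path_connect ep); rewrite E mem_cat mem_head orbT //.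
apply/connectP; exists w2 => //.
by rewrite yE -[last x p]/(last x (x :: p)) E last_cat.
Qed.

Lemma path_prefix_connect x q l1 p l2 u : path e x q -> x :: q = l1 ++ p :: l2 ->
  u \in rcons l1 p -> connect e u p.
Proof.
elim: l1 x q => [|y l1 IH] x q /=; first by rewrite inE => _ _ /eqP ->.
move=> pq [xy E]; rewrite inE => /predU1P[->|ul].
  by rewrite -xy; apply: (path_connect pq); rewrite inE E mem_cat mem_head !orbT.
case: q pq E => [_|x' q /=]; first by case: l1 {IH ul}.
by case/andP=> _ pq E; exact: IH pq E ul.
Qed.

Lemma in_dominates x y w : out_semicomplete e' ->
  e w y -> connect e x y -> connect e x w || e w x.
Proof.
move=> isc wy /connectP[p]; elim/last_ind: p y wy => [|p y IH] z wz.
  by move=> _ /= <-; rewrite wz orbT.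
rewrite rcons_path last_rcons => /andP[pp lz] zE.
rewrite zE in wz.
have cxl : connect e x (last x p) by apply/connectP; exists p.
have [<-|nw] := eqVneq (last x p) w; first by rewrite cxl.
(* The tail of the last arc and [w] are both in-neighbours of [z], hence adjacent: either [w]
   dominates this tail and the walk back continues, or [x] reaches [w]. *)
have /orP[/= h|/= h] := isc _ _ _ lz wz nw; first exact: (IH _ h).
by rewrite (connect_trans cxl (connect1 h)).
Qed.
End Reachability.

Lemma out_dominates (T : finType) (e : rel T) x y w : out_semicomplete e ->
  e y w -> connect e y x -> connect e w x || e x w.
Proof.
move=> osc yw.
by rewrite -(connect_conv e x y) => /(in_dominates osc yw); rewrite connect_conv.
Qed.

Section LocallySemicomplete.
Variables (T : finType) (e : rel T).
Local Notation e' := [rel x y | e y x].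
Hypothesis osc : out_semicomplete e.
Hypothesis isc : out_semicomplete e'.

Lemma in_dom x y w : e w y -> connect e x y -> ~~ connect e x w -> e w x.
Proof. by move=> wy xy /negPf nxw; have := in_dominates isc wy xy; rewrite nxw. Qed.

Lemma out_dom x y w : e y w -> connect e y x -> ~~ connect e w x -> e x w.
Proof. by move=> yw yx /negPf nwx; have := out_dominates osc yw yx; rewrite nwx. Qed.

(** A walk in the underlying graph from [x] to a vertex incomparable with [x] has consecutive
    vertices [a], [b] of which only [a] is comparable. In each of the four cases transitivity or
    domination makes [b] comparable too. *)
Lemma connect_total :
  (forall x y, connect [rel x y | e x y || e y x] x y) ->
  forall x y, connect e x y || connect e y x.
Proof.
move=> conn x y; apply/negPn/negP => nxy.
have [a [b [/= Pa Pb ab _ _]]] := @connect_cross _ _ [pred y | connect e x y || connect e y x] _ _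
  (introT orP (or_introl (connect0 e x))) nxy (conn x y).
move: Pb; rewrite negb_or => /andP[nxb nbx].
case/orP: ab => ab; case/orP: Pa => ax.
- by rewrite (connect_trans ax (connect1 ab)) in nxb.
- by rewrite (connect1 (out_dom ab ax nbx)) in nxb.
- by rewrite (connect1 (in_dom ab ax nxb)) in nbx.
- by rewrite (connect_trans (connect1 ab) ax) in nbx.
Qed.

Lemma path_insertable s q v u w1 a b w2 :
  path e s q -> v \notin s :: q -> s :: q = w1 ++ a :: b :: w2 ->
  u \in rcons w1 a -> e u v -> e v b -> insertable e (s :: q) v.
Proof.
move=> pq nv E; rewrite -cats1 => ua uv vb; move: pq nv.
have {}E : s :: q = (w1 ++ [:: a]) ++ b :: w2 by rewrite E -catA.
rewrite E; case: (splitPr ua) E => l1 l2; rewrite -catA => E.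
have b2 : b \in l2 ++ b :: w2 by rewrite mem_cat mem_head orbT.
move: E; case: l1 => [|s' l1] [-> ->] /=.
  move=> p0; rewrite inE negb_or => /andP[_ nv].
  exact: (slide osc p0 uv nv b2 vb).
rewrite cat_path /= => /and3P[p1 lu p2].
rewrite inE mem_cat inE !negb_or => /and4P[_ _ _ nv].
have := slide osc p2 uv nv b2 vb.
by move/(insertable_cat (s' :: l1) [::]); rewrite cats0.
Qed.

(** Suppose the end of the path does not reach [v]. The path leaves the set of vertices reaching [v]
    by an arc from [a] to [b], and [v] dominates [b]; as [v] does not fit in, no vertex up to [a]
    dominates it. This forces [v] to reach [a], then [s], so [v] lies in the first component. A walk
    from [s] to [v] leaves the path at an arc from [c] to some [d] in [U], and this [d] fits in. *)
Lemma insertable_or_sink s q (U : pred T) v :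
  path e s q -> (forall x, connect e s x) ->
  (forall x, connect e x s -> (x \in s :: q) || U x) ->
  (forall x, U x -> x \notin s :: q) ->
  (forall x, U x -> ~ insertable e (s :: q) x) ->
  U v -> connect e (last s q) v.
Proof.
move=> pq src cov disj nins Uv; apply/negPn/negP => nzv.
have first_after x : ~~ connect e (last s q) x ->
   exists w1 a b w2, [/\ s :: q = w1 ++ a :: b :: w2, connect e a x, ~~ connect e b x,
     e a b & e x b].
  move=> nzx; have [w1 [a [b [w2 [E cax cbx]]]]] :=
     @split_change _ [pred y | connect e y x] _ _ (src x) nzx.
  have [_ ab _] := path_split pq E; exists w1, a, b, w2; split=> //.
  exact: (out_dom ab cax cbx).
have no_in x w1 a b w2 u : U x -> s :: q = w1 ++ a :: b :: w2 -> e x b ->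
   u \in rcons w1 a -> ~~ e u x.
  move=> Ux E xb uw; apply/negP => ux.
  by apply: (nins x Ux); apply: (path_insertable pq (disj x Ux) E uw ux xb).
have [w1 [a [b [w2 [E cav cbv ab vb]]]]] := first_after v nzv.
have cvb : connect e v b := connect1 vb.
case cva: (connect e v a); last first.
  have av := in_dom ab cvb (negbT cva).
  by have := no_in v _ _ _ _ a Uv E vb; rewrite av mem_rcons mem_head => /(_ isT).
(* Otherwise an arc from [c] to [d] on the path up to [a] enters the set of vertices that [v]
   reaches, and its tail dominates [v]. *)
case cvs: (connect e v s); last first.
  have [l [E1 l1]] : exists l, rcons w1 a = s :: l /\ last s l = a.
    case: w1 E => [|s' w1] [-> _]; first by exists [::].
    by exists (rcons w1 a); rewrite last_rcons.
  have [] := @split_change _ [pred y | ~~ connect e v y] s l; first by rewrite /= cvs.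
    by rewrite l1 /= cva.
  move=> l1' [c [d [l2 [E2 /= cvc /negPn cvd]]]].
  have E3 : s :: q = l1' ++ c :: d :: (l2 ++ b :: w2).
    by rewrite E -cat_rcons E1 E2 -catA.
  have [_ cd _] := path_split pq E3.
  have cv := in_dom cd cvd cvc.
  suff: ~~ e c v by rewrite cv.
  apply: (no_in v _ _ _ _ c Uv E vb).
  by rewrite E1 E2 mem_cat mem_head orbT.
have [c [d [/= Pc Pd cd csc cdv]]] := @connect_cross _ _ [pred y | y \in s :: q] s v
   (mem_head _ _) (disj v Uv) (src v).
have Ud : U d by have := cov d (connect_trans cdv cvs); rewrite (negPf Pd).
have nzd : ~~ connect e (last s q) d.
  by apply/negP => zd; rewrite (connect_trans zd cdv) in nzv.
have [l1 [a' [b' [l2 [E' ca' cb' ab' db']]]]] := first_after d nzd.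
suff: ~~ e c d by rewrite cd.
apply: (no_in d _ _ _ _ c Ud E' db').
(* [c] comes no later than [a']: otherwise [b'] would reach [c] and hence [d]. *)
move: Pc; rewrite E' -cat_rcons mem_cat => /orP[//|cb].
have [_ _ p2] := path_split pq E'.
by rewrite (connect_trans (path_connect p2 cb) (connect1 cd)) in cb'.
Qed.

End LocallySemicomplete.

(** * Sequences that cannot be extended *)

Section Ears.
Variable (T : eqType) (e : rel T).
Implicit Types (U w : seq T).

(* [H] is the set reached by an exhaustive search from [a] through [U]. *)
Definition no_ear U a b : Prop :=
  exists H : seq T,
    [/\ a \in H, {subset H <= a :: U},
        forall h v, h \in H -> v \in U -> e h v -> v \in H
      & forall h, h \in H -> h != a -> ~~ e h b].

(** An ear has at least one internal vertex: [no_ear] exempts [a] itself, so an arc from [a] to [b]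
    does not count. *)
Definition stuck U w : Prop :=
  forall w1 a b w2, w = w1 ++ a :: b :: w2 -> no_ear U a b.

Lemma stuck_not_insertable U w v :
  (forall x, x \in U -> x \notin w) -> stuck U w -> v \in U -> ~ insertable e w v.
Proof.
move=> disj st Uv [w1 [a [b [w2 [E av vb]]]]].
have [H [aH _ clH nb]] := st _ _ _ _ E.
have va : v != a.
  by apply: contraTneq (disj v Uv) => ->; rewrite E mem_cat mem_head orbT.
by have := nb v (clH a v aH Uv av) va; rewrite vb.
Qed.

End Ears.

Lemma total_max (T : eqType) (r : rel T) x H : transitive r -> total r ->
  exists2 m, m \in x :: H & forall y, y \in x :: H -> r y m.
Proof.
move=> tr tot; have rr y : r y y by have := tot y y; rewrite orbb.
elim: H x => [|z H IH] x; first by exists x; rewrite ?mem_head // => y; rewrite inE => /eqP ->.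
have [m mH mx] := IH z; case/orP: (tot x m) => xm.
  by exists m; [rewrite inE mH orbT | move=> y; rewrite inE => /predU1P[->|/mx]].
exists x; first exact: mem_head.
by move=> y; rewrite inE => /predU1P[->|/mx h] //; exact: tr h xm.
Qed.

Lemma rev_cons_belast (T : Type) (s : T) q : rev (s :: q) = last s q :: rev (belast s q).
Proof. by rewrite lastI rev_rcons. Qed.


(** The arc slides from [c] to the end of the closed sequence, which is [x] again, and from there
    through all of it. The alternative is the starting pair, both of whose entries are [x]. *)
Lemma cycle_slide (T : eqType) (e : rel T) x q c v : out_semicomplete e ->
  last x q = x -> path e x q \/ q = [:: x] -> v \notin x :: q ->
  ~ insertable e (x :: q) v -> c \in x :: q -> e c v ->
  forall c', c' \in x :: q -> e c' v.
Proof.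
move=> osc lx [pq|->] nv nins cq cv c'; last first.
  by move: cq; rewrite !inE !orbb => /eqP <- /eqP ->.
have nvq : v \notin q by move: nv; rewrite inE negb_or => /andP[].
suff xv : e x v by apply: (slide_all osc pq xv nvq nins).
move: cq; rewrite inE => /predU1P[<- //|cq].
case: (splitPr cq) lx pq nvq nins => q1 q2.
rewrite last_cat cat_path /= mem_cat inE !negb_or => ll /and3P[_ _ p2] /and3P[_ _ n2] ni.
have := slide_all osc p2 cv n2 _ (mem_last _ _); rewrite ll; apply=> h; apply: ni.
by have := insertable_cat (x :: q1) [::] h; rewrite cats0.
Qed.

Section LocallySemicomplete.
Variables (T : finType) (e : rel T).
Local Notation e' := [rel x y | e y x].
Hypothesis osc : out_semicomplete e.
Hypothesis isc : out_semicomplete e'.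

(** A vertex of [U] with an arc from the closed sequence has arcs from all of it, and dually. By
    strong connectivity [x] dominates some [v] in [U], and a walk from [v] back to [x] leaves the
    part of the search set in [U] by an arc to the closed sequence. The tail of this arc then
    dominates the successor of [x], which gives an ear. *)
Lemma stuck_cycle_spans x q (U : seq T) :
  (forall x y, connect e x y) ->
  last x q = x -> q != [::] -> path e x q \/ q = [:: x] ->
  (forall v, (v \in U) = (v \notin x :: q)) -> stuck e U (x :: q) -> U = [::].
Proof.
move=> strong lx q0 pq UE st.
case: U UE st => // v0 U0; set U := v0 :: U0 => UE st.
have disj v : v \in U -> v \notin x :: q by rewrite UE.
have nins v : v \in U -> ~ insertable e (x :: q) v by exact: stuck_not_insertable.
have v0U : v0 \in U by exact: mem_head.
have revE : rev (x :: q) = x :: rev (belast x q) by rewrite rev_cons_belast lx.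
have into c v : v \in U -> c \in x :: q -> e c v -> forall c', c' \in x :: q -> e c' v.
  by move=> vU cq cv; apply: (cycle_slide osc lx pq (disj v vU) (nins v vU) cq cv).
have outof c v : v \in U -> c \in x :: q -> e v c -> forall c', c' \in x :: q -> e v c'.
  move=> vU cq vc c' c'q.
  apply: (@cycle_slide _ e' x (rev (belast x q)) c) => //.
  - by case: (q) q0 lx => // y q1 _ _; rewrite /= rev_cons last_rcons.
  - by case: pq => [pq|->]; [left; rewrite -[X in path _ X]lx rev_path | right].
  - by rewrite -revE mem_rev disj.
  - by rewrite -revE => /insertable_rev; exact: nins.
  - by rewrite -revE mem_rev.
  - by rewrite -revE mem_rev.
have [c [v [/= cq vU cv _ _]]] := @connect_cross _ e [pred y | y \in x :: q] x v0
  (mem_head _ _) (disj v0 v0U) (strong _ _).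
rewrite -UE in vU.
have [y [q' qE]] : exists y q', q = y :: q' by case: (q) q0 => // y q' _; exists y, q'.
have [H [xH HU clH nb]] := st [::] x y q' (congr1 (cons x) qE).
have yq : y \in x :: q by rewrite qE !inE eqxx orbT.
have vH : v \in H.
  by apply: (clH x) => //; apply: (into c) => //; exact: mem_head.
pose P := [pred h | (h \in H) && (h \in U)].
have nPx : ~~ P x by rewrite /= UE mem_head andbF.
have [|h [u [/= /andP[hH hU] nPu hu _ _]]] := @connect_cross _ e P v x _ nPx (strong _ _).
  by rewrite /= vH.
case uU : (u \in U); first by rewrite /= uU (clH h) in nPu.
have uq : u \in x :: q by rewrite UE in uU; move/negPn: uU.
have hy : e h y by apply: (outof u).
have hx : h != x by apply: contraTneq hU => ->; rewrite UE mem_head.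
by have := nb h hH hx; rewrite hy.
Qed.

(** [F] consists of the forbidden vertices and avoids both end components. By [insertable_or_sink],
    for the path and for its reverse in the converse digraph, a remaining vertex would lie in the
    last and in the first component at once. *)
Lemma stuck_path_spans s z q (U : seq T) (F : pred T) :
  path e s q -> last s q = z ->
  (forall x, connect e s x) -> (forall x, connect e x z) -> ~~ connect e z s ->
  (forall x, connect e x s -> ~~ F x) -> (forall x, connect e z x -> ~~ F x) ->
  (forall v, (v \in U) = (v \notin s :: q) && ~~ F v) ->
  stuck e U (s :: q) -> U = [::].
Proof.
move=> pq lq src snk nzs Fs Fz UE st.
have disj v : v \in U -> v \notin s :: q by rewrite UE => /andP[].
have nins v : v \in U -> ~ insertable e (s :: q) v by exact: stuck_not_insertable.
case: U UE st disj nins => // v0 U0; set U := v0 :: U0 => UE st disj nins.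
have v0U : v0 \in U by exact: mem_head.
have zv : connect e z v0.
  rewrite -lq; apply: (@insertable_or_sink _ e osc isc s q (mem U)) => // x xs.
  by rewrite /= UE Fs // andbT orbN.
have revE : rev (s :: q) = z :: rev (belast s q) by rewrite rev_cons_belast lq.
have lE : last z (rev (belast s q)) = s.
  by case: (q) lq => [|y q1] //= _; rewrite rev_cons last_rcons.
have vs : connect e v0 s.
  rewrite -(connect_conv e) -{1}lE.
  apply: (@insertable_or_sink _ e' isc osc z _ (mem U)) => //.
  - by rewrite -lq rev_path.
  - by move=> x; rewrite connect_conv.
  - by move=> x; rewrite connect_conv -revE mem_rev /= UE => zx; rewrite Fz // andbT orbN.
  - by move=> x xU; rewrite -revE mem_rev disj.
  - by move=> x xU; rewrite -revE => /insertable_rev; exact: nins.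
by rewrite (connect_trans zv vs) in nzs.
Qed.

(* The last condition says that [y] lies in the last strong component having an
   in-neighbour in the component of [x]. *)
Definition greedy_step : rel T :=
  [rel x y | [&& e x y, ~~ connect e y x & [forall v, e x v ==> connect e v y]]].

Lemma greedy_stepP x y : reflect
  [/\ e x y, ~~ connect e y x & forall v, e x v -> connect e v y] (greedy_step x y).
Proof.
apply: (iffP and3P) => [[? ? /forallP h]|[? ? h]]; split=> //.
  by move=> v xv; have := h v; rewrite xv.
by apply/forallP => v; apply/implyP; exact: h.
Qed.

Lemma greedy_path x c : path greedy_step x c -> path e x c.
Proof. by apply: sub_path => a b /greedy_stepP[]. Qed.

(** * Levels along a greedy path, and the use of 2-connectedness *)

Definition level c v := count [pred p | ~~ connect e v p] c.

Lemma level_mono c v w : connect e v w -> level c v <= level c w.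
Proof. by move=> vw; apply: sub_count => p; apply: contra; exact: connect_trans. Qed.

Lemma level_greedy0 x c v : path greedy_step x c -> connect e v x -> level (x :: c) v = 0.
Proof.
move=> /greedy_path pc vx; apply/eqP; rewrite -leqn0 leqNgt -has_count; apply/hasPn => p pc'.
by rewrite /= negbK (connect_trans vx (path_connect pc pc')).
Qed.

Lemma level_cons x c v : level (x :: c) v = ~~ connect e v x + level c v.
Proof. by []. Qed.

(** If [v] does not reach [x], the entry [x] already counts for [v] and induction handles the rest.
    If it does, then [w] reaches the next entry [y]: either [w] reaches [x], or [x] dominates [w]
    and the greedy choice of [y] applies. So at most the entry [x] counts for [w]. *)
Lemma level_step x c v w : path greedy_step x c -> e v w ->
  level (x :: c) w <= (level (x :: c) v).+1.
Proof.
elim: c x => [|y c IH] x; first by rewrite /= => _ _; case: (~~ _).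
move=> pxy; rewrite level_cons (level_cons x _ v); case vx: (connect e v x); last first.
  move=> vw; have /andP[_ py] := pxy; have := IH y py vw.
  by case: (connect e w x) => h; rewrite !(add0n, add1n) ?ltnS //; exact: leqW.
move=> vw; have /andP[/greedy_stepP[xy _ gr] py] := pxy.
suff wy : connect e w y by rewrite (level_greedy0 py wy) addn0; case: (~~ _).
case wx: (connect e w x); first by rewrite (connect_trans wx (connect1 xy)).
by apply: gr; rewrite (out_dom osc vw vx) ?wx.
Qed.

(** The form in which 2-connectedness enters: if both sides of the cut after the component of [m]
    contain a vertex other than [v], deleting [v] leaves [m] an out-neighbour in a later
    component. *)
Definition skips_every_vertex : Prop := forall v m x z,
  x != v -> connect e x m -> z != v -> ~~ connect e z m ->
  exists y, [/\ y != v, e m y & ~~ connect e y m].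

Lemma greedy_strict x c y : path greedy_step x c -> y \in c -> ~~ connect e y x.
Proof.
case: c => // x1 c pc yc; move: (pc) => /andP[/greedy_stepP[_ nx _] pc1].
by apply: contra nx => h; rewrite (connect_trans (path_connect (greedy_path pc1) yc) h).
Qed.

(** Some arc leaves the set of vertices reaching [m]; domination moves its tail to [m]. *)
Lemma exit_arc m z : connect e m z -> ~~ connect e z m ->
  exists2 y, e m y & ~~ connect e y m.
Proof.
move=> mz nzm.
have [a [b [/= am nbm ab _ _]]] := @connect_cross _ e [pred x | connect e x m] m z
  (connect0 e m) nzm mz.
by exists b => //; exact: (out_dom osc ab am nbm).
Qed.

Hypothesis total : forall x y, connect e x y || connect e y x.

(** If all out-neighbours of [m] in later components were on [c], every vertex preceding one of them
    on the greedy path would reach [m]. But 2-connectedness yields two such out-neighbours, and the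
    earlier one, preceding the other, would reach [m]. *)
Lemma greedy_gap s z c m : skips_every_vertex ->
  path greedy_step s c -> e (last s c) z -> ~~ connect e z (last s c) ->
  (forall x, connect e s x) -> (forall x, connect e x z) -> ~~ connect e z m ->
  exists y, [/\ e m y, ~~ connect e y m & y \notin c].
Proof.
move=> skip pc lz nzl src snk nzm.
case: (boolP [exists y, [&& e m y, ~~ connect e y m & y \notin c]]).
  by case/existsP=> y /and3P[]; exists y.
move/existsPn=> O'.
have {}O y : e m y -> ~~ connect e y m -> y \in c.
  by move=> my nym; have := O' y; rewrite my nym negbK.
have zc x : x \in s :: c -> ~~ connect e z x.
  move=> xc; apply: contra nzl => /connect_trans; apply.
  move: xc; rewrite inE => /predU1P[-> //|xc].
  case: (splitPr xc) pc => c1 c2; rewrite last_cat cat_path /= => /and3P[_ _ p2].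
  by rewrite (path_connect (greedy_path p2) (mem_last _ _)).
have pe := greedy_path pc.
(* If [p] were strictly after [m], skipping [y] would give [p] another out-neighbour [y'] in a later
   component. It reaches [y] by the greedy choice, so [m] dominates it and it is on [c]; but it can
   lie neither before nor after [y]. *)
have pred_reach l1 p y l2 : s :: c = l1 ++ p :: y :: l2 ->
    e m y -> ~~ connect e y m -> connect e p m.
  move=> E my nym; apply/negPn/negP => npm.
  have mp : connect e m p by have := total m p; rewrite (negPf npm) orbF.
  have sy : s != y by apply: contraNneq nym => <-.
  have zy : z != y.
    by apply: contraNneq (zc y _) => [->//|]; rewrite E mem_cat !inE eqxx !orbT.
  have zp : ~~ connect e z p by apply: zc; rewrite E mem_cat mem_head orbT.
  have [y' [y'y py' ny'p]] := skip _ _ _ _ sy (src p) zy zp.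
  have [_ /greedy_stepP[py _ gr] p2] := path_split pc E.
  have ny'm : ~~ connect e y' m by apply: contra ny'p => h; exact: connect_trans h mp.
  have my' : e m y' := in_dom isc my (gr _ py') ny'm.
  have : y' \in s :: c by rewrite inE O ?orbT.
  rewrite E -cat_rcons mem_cat inE (negPf y'y) => /orP[h|h].
    by rewrite (path_prefix_connect pe E h) in ny'p.
  by have := greedy_strict p2 h; rewrite gr.
have before l1 y l2 u : s :: c = l1 ++ y :: l2 ->
    e m y -> ~~ connect e y m -> u \in l1 -> connect e u m.
  case/lastP: l1 => [//|l1 p] E my nym ul.
  rewrite cat_rcons in E.
  exact: connect_trans (path_prefix_connect pe E ul) (pred_reach _ _ _ _ E my nym).
have [y my nym] := exit_arc (snk m) nzm.
have yc := O y my nym.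
have sy : s != y by apply: contraNneq nym => <-.
have zy : z != y by apply: contraNneq (zc y _) => [->//|]; rewrite inE yc orbT.
have [y2 [y2y my2 ny2m]] := skip _ _ _ _ sy (src m) zy nzm.
have y2c : y2 \in s :: c by rewrite inE O ?orbT.
have {}yc : y \in s :: c by rewrite inE yc orbT.
have [l1 [l2 E]] := mem_split yc.
move: (y2c); rewrite E mem_cat inE (negPf y2y) => /orP[h|h].
  by rewrite (before _ _ _ _ E my nym h) in ny2m.
have [l3 [l4 E2]] := mem_split h; rewrite E2 -cat_cons catA in E.
by rewrite (before _ _ _ y E my2 ny2m) ?mem_cat ?mem_head ?orbT in nym.
Qed.

(* Without the arc [s z] the sequence [[:: s; z]] is not a path; a vertex of the
   search set with no arc to a later component outside [c] is excluded by
   [greedy_gap]. *)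
Lemma stuck_pair_arc s z c (U : seq T) : skips_every_vertex ->
  path greedy_step s c -> e (last s c) z -> ~~ connect e z (last s c) ->
  (forall x, connect e s x) -> (forall x, connect e x z) -> ~~ connect e z s ->
  (forall x, connect e z x -> x \notin c) ->
  (forall v, (v \in U) = (v \notin [:: s; z]) && (v \notin c)) ->
  stuck e U [:: s; z] -> e s z.
Proof.
move=> skip pc lz nzl src snk nzs zc UE st.
have [H [sH HU clH nb]] := st [::] s z [::] erefl.
apply/negPn/negP => nsz.
have ctr : transitive (connect e) by move=> y x x'; exact: connect_trans.
(* [m] is a vertex of the search set in the latest possible component. *)
have [m mH mmax] : exists2 m, m \in H & forall y, y \in H -> connect e y m.
  by case: (H) sH => // h0 H0 _; exact: total_max.
have zH : z \notin H.
  apply/negP => /HU; rewrite inE UE !inE eqxx orbT orbF => /eqP zs.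
  by rewrite zs connect0 in nzs.
have nhz h : h \in H -> ~~ e h z.
  by move=> hH; have [->//|hs] := eqVneq h s; exact: nb.
(* Otherwise a path from [m] to [z] leaves [H] within the last component, at a vertex [b] different
   from [z]. That component contains neither [s] nor a vertex of [c], so [b] is in [U] and would be
   in [H]. *)
have nzm : ~~ connect e z m.
  apply/negP => zm.
  have [a [b [/= aH nbH ab ma bz]]] :=
    @connect_cross _ e [pred h | h \in H] m z mH zH (snk m).
  have zb : connect e z b := connect_trans (connect_trans zm ma) (connect1 ab).
  have bs : b != s by apply: contraNneq nzs => <-.
  have bz' : b != z by apply: contraTneq ab => ->; exact: nhz.
  have bU : b \in U by rewrite UE !inE negb_or bs bz' zc.
  by rewrite (clH _ _ aH bU ab) in nbH.
have [y [my nym yc]] := greedy_gap skip pc lz nzl src snk nzm.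
have ys : y != s by apply: contraNneq nym => ->.
have yz : y != z by apply: contraTneq my => ->; exact: nhz.
have yU : y \in U by rewrite UE !inE negb_or ys yz yc.
by rewrite (mmax _ (clH _ _ mH yU my)) in nym.
Qed.

End LocallySemicomplete.

(** * The algorithm *)

Section Algorithm.
Variables (T : finType) (e : rel T).
Implicit Types (x y v a b p s z : T) (q r w U V F K pre : seq T) (L : seq (T * seq T)).

Definition remove r U := [seq v <- U | v \notin r].

Lemma mem_remove r U v : (v \in remove r U) = (v \notin r) && (v \in U).
Proof. by rewrite mem_filter. Qed.

Lemma size_filter_ltn (P Q : pred T) V v : subpred P Q -> v \in V -> Q v -> ~~ P v ->
  size (filter P V) < size (filter Q V).
Proof.
move=> PQ; elim: V => //= y V IH; rewrite inE.
have le : size (filter P V) <= size (filter Q V) by rewrite !size_filter sub_count.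
case/predU1P=> [<- Qv nPv|vV Qv nPv]; first by rewrite Qv (negPf nPv) ltnS.
have lt := IH vV Qv nPv.
by case Py: (P y); [rewrite (PQ _ Py) | case: (Q y) => //=; exact: leqW].
Qed.

(* A partial path is kept reversed, as its end point and the rest of it. *)
Fixpoint find_tail v L : option (T * seq T) :=
  if L is pi :: L' then if e pi.1 v then Some pi else find_tail v L' else None.

Fixpoint find_extension L U : option (T * seq T) :=
  if U is v :: U' then
    if find_tail v L is Some pi then Some (v, pi.1 :: pi.2) else find_extension L U'
  else None.

(** [K] is fuel, of which only the length matters. Each round moves a vertex from [U] to the end
    points in [L], so [size U] rounds are enough. *)
Fixpoint search b L U K : option (T * seq T) :=
  if K is _ :: K' then
    if find_extension L U is Some pi then
      if e pi.1 b then Some pi else search b (pi :: L) (remove [:: pi.1] U) K'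
    else None
  else None.

(** [pre] is the reversed part of the sequence before [a]. The search carries it inside its partial
    paths, so a single [catrev] rebuilds the whole sequence with the ear spliced in. *)
Fixpoint extend U pre w : seq T :=
  if w is a :: w' then
    if w' is b :: _ then
      if search b [:: (a, pre)] U U is Some pi then catrev (pi.1 :: pi.2) w'
      else extend U (a :: pre) w'
    else catrev pre w
  else [::].

Definition unvisited V F w := remove F (remove w V).

Fixpoint saturate V F w K : seq T :=
  if K is _ :: K' then saturate V F (extend (unvisited V F w) [::] w) K' else w.

Definition climb V b := foldl (fun b v => if e v b then v else b) b V.
Definition source V b K := foldl (fun b _ => climb V b) b K.
(** The fold starts at [p], where the two tests coincide, so the first out-neighbour found is
    accepted; without any, the value stays [p], a default. *)
Definition next_greedy V p := foldl (fun b v => if e p v && e b v then v else b) p V.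
Definition sink V b K := foldl (fun b _ => next_greedy V b) b K.

Fixpoint greedy_walk V z p acc K : seq T :=
  if K is _ :: K' then
    if e p z then acc
    else greedy_walk V z (next_greedy V p) (next_greedy V p :: acc) K'
  else acc.

(** An empty remainder after the first saturation is the test for strong connectivity; [behead] then
    drops the repeated start. Otherwise [F] lists the internal vertices of the greedy path in
    reverse, and the double [catrev] appends it to the directed path from [s] to [z]. *)
Definition hamilton V : seq T :=
  if V is x :: _ then
    let w := saturate V [::] [:: x; x] V in
    if remove w V is _ :: _ then
      let s := source V x V in
      let z := sink V s V in
      let F := greedy_walk V z s [::] V in
      catrev (catrev (saturate V F [:: s; z] V) [::]) F
    else behead w
  else [::].

Lemma find_tailP v L :
  if find_tail v L is Some pi then pi \in L /\ e pi.1 v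
  else forall pi, pi \in L -> ~~ e pi.1 v.
Proof.
elim: L => [//|pi L IH] /=; case: (boolP (e pi.1 v)) => ev; first by rewrite mem_head.
case: (find_tail v L) IH => [pi' [h1 h2]|h]; first by rewrite inE h1 orbT.
by move=> pi'; rewrite inE => /predU1P[->|/h].
Qed.

Lemma find_extensionP L U :
  if find_extension L U is Some pi' then
    exists v pi, [/\ pi' = (v, pi.1 :: pi.2), v \in U, pi \in L & e pi.1 v]
  else forall v pi, v \in U -> pi \in L -> ~~ e pi.1 v.
Proof.
elim: U => [//|v U IH] /=; have := find_tailP v L.
case: (find_tail v L) => [pi [h1 h2]|h]; first by exists v, pi; rewrite mem_head.
case: (find_extension L U) IH => [pi' [u [pi [-> uU piL eu]]]|h2].
  by exists u, pi; rewrite inE uU orbT.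
by move=> u pi; rewrite inE => /predU1P[->|uU] piL; [exact: h | exact: h2].
Qed.

Definition ear_prefix U a pre (pi : T * seq T) r : Prop :=
  [/\ path e a r, uniq r, {subset r <= U}, pi.1 = last a r
    & pi.1 :: pi.2 = catrev r (a :: pre)].

(** The end points of [L] are the vertices found so far; when the search runs dry, they form the
    exhausted set required by [no_ear]. Partial ears avoid [U], which keeps their extensions free of
    repetitions. *)
Lemma search_invariant U0 a pre b L U K :
  (forall pi, pi \in L ->
     exists2 r, ear_prefix U0 a pre pi r & forall x, x \in r -> x \notin U) ->
  {subset U <= U0} -> (forall x, x \in U0 -> (x \in U) || (x \in map fst L)) ->
  {subset map fst L <= a :: U0} -> a \in map fst L ->
  (forall h, h \in map fst L -> h != a -> ~~ e h b) -> size U <= size K ->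
  if search b L U K is Some pi then
    exists r, [/\ ear_prefix U0 a pre pi r, r != [::] & e pi.1 b]
  else no_ear e U0 a b.
Proof.
elim: K L U => [|k K IH] L U earL UU0 cov LU0 aL nb szU /=.
  case: U szU cov {earL UU0} => // _ cov; exists (map fst L); split=> // h v _ vU _.
  by have := cov v vU.
have := find_extensionP L U; case: (find_extension L U); last first.
  move=> none; exists (map fst L); split=> // h v /mapP[pi piL ->] vU hv.
  by have /orP[vU'|//] := cov v vU; have := none v pi vU' piL; rewrite hv.
move=> _ [v [pi [-> vU piL ev]]] /=.
have ear' : exists2 r, ear_prefix U0 a pre (v, pi.1 :: pi.2) r &
      [/\ r != [::] & forall x, x \in r -> x \notin remove [:: v] U].
  have [r [pr ur rU lr rE] dr] := earL _ piL; exists (rcons r v); split.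
  - by rewrite rcons_path pr -lr.
  - by rewrite rcons_uniq ur andbT; apply: contraL vU => /dr.
  - by move=> x; rewrite mem_rcons inE => /predU1P[->|/rU //]; exact: UU0.
  - by rewrite last_rcons.
  - by rewrite rE /= !catrevE rev_rcons.
  - by case: (r).
  - move=> x; rewrite mem_rcons inE mem_remove inE => /predU1P[->|/dr xU]; first by rewrite eqxx.
    by rewrite (negPf xU) andbF.
case: (boolP (e v b)) => vb; first by case: ear' => r h [h1 _]; exists r.
apply: IH => //=.
- move=> pi'; rewrite inE => /predU1P[->|pi'L]; first by case: ear' => r h [_ h1]; exists r.
  have [r h dr] := earL _ pi'L; exists r => // x /dr.
  by rewrite mem_remove negb_and orbC => ->.
- by move=> x; rewrite mem_remove => /andP[_ /UU0].
- move=> x /cov; rewrite mem_remove !inE.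
  by case: (x == v) => //=; rewrite ?orbT.
- by move=> x; rewrite inE => /predU1P[->|/LU0 //]; rewrite inE UU0 ?orbT.
- by rewrite inE aL orbT.
- by move=> h; rewrite inE => /predU1P[-> //|/nb].
rewrite -ltnS; apply: leq_trans szU.
rewrite -[X in _ < size X](filter_predT U).
by apply: (@size_filter_ltn _ _ _ v) => //=; rewrite inE eqxx.
Qed.

Lemma searchP U a pre b :
  if search b [:: (a, pre)] U U is Some pi then
    exists r, [/\ ear_prefix U a pre pi r, r != [::] & e pi.1 b]
  else no_ear e U a b.
Proof.
apply: search_invariant => //=.
- by move=> pi; rewrite inE => /eqP ->; exists [::].
- by move=> x ->.
- by move=> x; rewrite !inE => ->.
- by rewrite inE.
- by move=> h; rewrite inE => ->.
Qed.

Lemma extendP U pre w : w != [::] ->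
  (extend U pre w = catrev pre w /\ stuck e U w) \/
  exists w1 a r b w2,
    [/\ w = w1 ++ a :: b :: w2, r != [::], uniq r & {subset r <= U}] /\
    path e a (rcons r b) /\ extend U pre w = catrev pre (w1 ++ a :: r ++ b :: w2).
Proof.
elim: w pre => [//|a w IH] pre _; case: w IH => [|b w] IH.
  by left; split=> // -[|? []].
rewrite [extend _ _ _]/=; have := searchP U a pre b.
case: (search _ _ _ _) => [pi [r [[pr ur rU lr rE] r0 eb]]|nab].
  right; exists [::], a, r, b, w; split=> //; split; first by rewrite rcons_path pr -lr.
  rewrite -[LHS]/(catrev (pi.1 :: pi.2) (b :: w)) rE !catrevE.
  by rewrite rev_cat revK rev_cons -cats1 -!catA.
have [//|[h st]|[w1 [c [r [d [w2 [[wE r0 ur rU] [pr h]]]]]]]] := IH (a :: pre).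
  left; split; first exact: h.
  move=> [|y w1] c d w2 /= []; first by move=> <- <- _.
  by move=> _ /st.
right; exists (a :: w1), c, r, d, w2; split; first by rewrite wE.
by split=> //; rewrite -[LHS]/(extend U (a :: pre) (b :: w)) h.
Qed.

(** The alternative [size q = 1] covers the starting pairs, which become paths as soon as they
    receive an ear. *)
Lemma splice s q w1 a r b w2 : s :: q = w1 ++ a :: b :: w2 ->
  path e s q \/ size q = 1 -> path e a (rcons r b) ->
  exists q', [/\ w1 ++ a :: r ++ b :: w2 = s :: q', perm_eq q' (r ++ q),
                 last s q' = last s q & path e s q'].
Proof.
case: w1 => [|s' w1] [-> ->] pq; rewrite rcons_path => /andP[pr lb].
  exists (r ++ b :: w2); split=> //; first by rewrite last_cat.
  by rewrite cat_path pr /= lb; case: pq => [/andP[]//|[]]; case: (w2).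
exists (w1 ++ a :: r ++ b :: w2); split=> //.
- by rewrite -[w1 ++ a :: r ++ _]cat_rcons -[w1 ++ a :: b :: _]cat_rcons perm_catCA.
- by rewrite !last_cat /= last_cat.
have {pq} : path e s' (w1 ++ a :: b :: w2).
  by case: pq => //; rewrite size_cat /= !addnS.
by rewrite !cat_path /= cat_path pr /= lb => /and4P[-> -> _ ->].
Qed.

(** * Inserting ears as long as possible *)

Section Saturate.
Variables (V F : seq T) (s t : T).
Hypothesis VT : forall x, x \in V.

(** For [s = t] the sequence is closed and its last entry repeats the first. The final alternative
    is the starting pair. *)
Definition valid w : Prop :=
  exists q, [/\ w = s :: q, last s q = t, uniq q, (s == t) || (s \notin q)
    & forall x, x \in w -> x \notin F] /\ (path e s q && (q != [::]) \/ q = [:: t]).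

Lemma mem_unvisited w x : (x \in unvisited V F w) = (x \notin w) && (x \notin F).
Proof. by rewrite !mem_remove VT andbT andbC. Qed.

Lemma valid_extend w : valid w ->
  let w' := extend (unvisited V F w) [::] w in
  (w' = w /\ stuck e (unvisited V F w) w) \/
  (valid w' /\ size (unvisited V F w') < size (unvisited V F w)).
Proof.
case=> q [[wE lq uq sq dF] pq] w'; rewrite {}/w'.
have [//|[-> st]|] := @extendP (unvisited V F w) [::] w; first by rewrite wE.
  by left.
case=> w1 [a [r [b [w2 [[wE' r0 ur rU] [pr ->]]]]]]; right.
rewrite -[catrev _ _]/(w1 ++ a :: r ++ b :: w2).
have [||q' [-> pm lq' pq']] := @splice s q w1 a r b w2 _ _ pr; first by rewrite -wE.
  by case: pq => [/andP[? _]|->]; [left|right].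
have qr x : x \in r -> (x \notin s :: q) && (x \notin F).
  by move/rU; rewrite mem_unvisited wE.
have memq x : (x \in s :: q') = (x \in r) || (x \in s :: q).
  by rewrite !inE (perm_mem pm) mem_cat orbCA.
split.
  exists q'; split; last first.
    left; rewrite pq' /=; apply: contraNneq r0 => q'0.
    by move/perm_size: pm; rewrite q'0 size_cat; case: (r).
  split=> //; first by rewrite lq'.
  - rewrite (perm_uniq pm) cat_uniq ur uq andbT; apply/hasPn => x xq /=.
    by apply/negP => /qr; rewrite inE xq orbT.
  - case/orP: sq => [-> //|nsq]; rewrite (perm_mem pm) mem_cat negb_or nsq andbT.
    by apply/orP; right; apply/negP => /qr; rewrite inE eqxx.
  - by move=> x; rewrite memq => /orP[/qr /andP[]//|]; rewrite -wE; exact: dF.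
case: r r0 rU {pr pm lq' ur} qr memq => // v r _ rU qr memq.
have [vq vF] := andP (qr v (mem_head _ _)).
rewrite /unvisited /remove -!filter_predI; apply: (@size_filter_ltn _ _ _ v) => //=.
- by move=> x /=; rewrite memq negb_or wE => /and3P[-> _ ->].
- by rewrite vF wE vq.
- by rewrite memq mem_head /= andbF.
Qed.

Lemma saturate_fix w K : extend (unvisited V F w) [::] w = w -> saturate V F w K = w.
Proof. by move=> h; elim: K => //= k K; rewrite h. Qed.

Lemma saturateP w K : valid w -> size (unvisited V F w) <= size K ->
  let w' := saturate V F w K in valid w' /\ stuck e (unvisited V F w') w'.
Proof.
elim: K w => [|k K IH] w vw szK /=.
  split=> //; case: (unvisited V F w) szK => // _ w1 a b w2 _.
  (* With no unvisited vertex left, the search set is [a] alone. *)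
  by exists [:: a]; split=> [|//|//|h]; rewrite inE // => ->.
have [[h st]|[vw' lt]] := valid_extend vw.
  by rewrite h saturate_fix.
by apply: IH => //; rewrite -ltnS (leq_trans lt).
Qed.

End Saturate.

(** * Finding the end components and the greedy path *)

Section Greedy.
Variable V : seq T.
Hypothesis VT : forall x, x \in V.
Hypothesis osc : out_semicomplete e.
Hypothesis isc : out_semicomplete [rel x y | e y x].
Hypothesis total : forall x y, connect e x y || connect e y x.

Lemma foldl_measure (f : T -> T) (good : pred T) (mu : T -> nat) b K :
  (forall b, good b -> good (f b)) -> (forall b, ~~ good b -> mu (f b) < mu b) ->
  mu b <= size K -> good (foldl (fun b _ => f b) b K).
Proof.
move=> gf mf le; have {le} : good b || (mu b <= size K) by rewrite le orbT.
elim: K b => [|k K IH] b /= gb.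
  by case/orP: gb => // mu0; apply/negPn/negP => /mf; rewrite ltnNge (leq_trans mu0).
apply: IH; case: (boolP (good b)) gb => [gb _|/mf lt /= le]; first by rewrite gf.
by rewrite -ltnS (leq_trans lt le) orbT.
Qed.

Definition is_source b := [forall x, connect e b x].
Definition is_sink b := [forall x, connect e x b].

Lemma climb_connect l c : connect e (climb l c) c.
Proof.
elim: l c => [|y l IH] c /=; first exact: connect0.
by case: ifP => // yc; exact: connect_trans (IH y) (connect1 yc).
Qed.

(** When the pass comes to [v], the current vertex either reaches [v], and is already in a component
    before that of [b], or is dominated by [v], which is then taken. Later moves only go further
    back. *)
Lemma climb_progress l b b0 v : v \in l -> e v b -> ~~ connect e b v -> connect e b0 b ->
  connect e (climb l b0) b0 /\ ~~ connect e b (climb l b0).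
Proof.
move=> vl vb nbv b0b; split; first exact: climb_connect.
elim: l b0 vl b0b => //= y l IH b0; rewrite inE => /predU1P[<-|vl] b0b; last first.
  apply: IH => //; case: ifP => // yb0.
  exact: connect_trans (connect1 yb0) b0b.
case: (boolP (connect e b0 v)) => [b0v|nb0v]; last first.
  rewrite (in_dom isc vb b0b nb0v); apply: contra nbv => h.
  exact: connect_trans h (climb_connect l v).
have nbb0 : ~~ connect e b b0 by apply: contra nbv => h; exact: connect_trans h b0v.
apply: contra nbb0 => h; apply: connect_trans h (connect_trans (climb_connect l _) _).
by case: ifP => // vb0; exact: connect1.
Qed.

Lemma is_source_source b K : #|T| <= size K -> is_source (source V b K).
Proof.
move=> szK; apply: (@foldl_measure _ _ (fun b => #|[pred x | connect e x b]|)).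
- move=> c /forallP sc; apply/forallP => x.
  exact: connect_trans (climb_connect V c) (sc x).
- move=> c /forallPn[x ncx].
  have xc : connect e x c by have := total c x; rewrite (negPf ncx).
  have [y cy nyc] : exists2 y, e y c & ~~ connect e c y.
    have := @exit_arc T [rel x y | e y x] isc c x.
    rewrite (connect_conv e c x) (connect_conv e x c) => /(_ xc ncx) [y cy nyc].
    by exists y => //; rewrite -(connect_conv e y c).
  have [h1 h2] := climb_progress (VT y) cy nyc (connect0 _ c).
  apply: proper_card; apply/properP; split.
    by apply/subsetP => u; rewrite !inE => /connect_trans; apply.
  by exists c; rewrite !inE ?connect0.
- by apply: leq_trans szK; exact: max_card.
Qed.

(** An out-neighbour of [p] that is passed over is adjacent to the current [b] without being
    dominated by it, so it dominates [b] unless it equals [b]. Thus everything seen reaches the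
    final value. *)
Lemma next_greedy_fold p l b : e p b ->
  let f := foldl (fun b v => if e p v && e b v then v else b) b l in
  [/\ e p f, connect e b f & forall v, v \in l -> e p v -> connect e v f].
Proof.
elim: l b => [|y l IH] b pb /=; first by split=> //; exact: connect0.
case: (boolP (e p y && e b y)) => [/andP[py yb]|nby].
  have [h1 h2 h3] := IH y py; split=> //; first exact: connect_trans (connect1 yb) h2.
  by move=> v; rewrite inE => /predU1P[-> //|]; exact: h3.
have [h1 h2 h3] := IH b pb; split=> // v; rewrite inE => /predU1P[-> py|]; last exact: h3.
have [-> //|yb] := eqVneq y b.
rewrite py /= in nby; have := osc py pb yb; rewrite (negPf nby) orbF => h.
exact: connect_trans (connect1 h) h2.
Qed.

Lemma next_greedyP p : [/\ next_greedy V p = p & forall v, ~~ e p v] \/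
  e p (next_greedy V p) /\ forall v, e p v -> connect e v (next_greedy V p).
Proof.
suff: (next_greedy V p = p /\ forall v, v \in V -> ~~ e p v) \/
  e p (next_greedy V p) /\ forall v, v \in V -> e p v -> connect e v (next_greedy V p).
  by case=> [] [h1 h2]; [left | right]; split=> // v; exact: h2.
rewrite /next_greedy; elim: V => [|y l IH] /=; first by left.
rewrite andbb; case: (boolP (e p y)) => py.
  have [h1 h2 h3] := next_greedy_fold l py; right; split=> // v.
  by rewrite inE => /predU1P[-> //|]; exact: h3.
case: IH => [[h1 h2]|[h1 h2]]; [left | right]; split=> // v; rewrite inE => /predU1P[->//|].
- exact: h2.
- by rewrite (negPf py).
- exact: h2.
Qed.

Lemma greedy_step_next p z : connect e p z -> ~~ connect e z p ->
  greedy_step e p (next_greedy V p).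
Proof.
move=> pz nzp; have [v pv nvp] := exit_arc osc pz nzp.
have [[_ /(_ v)]|[h1 h2]] := next_greedyP p; first by rewrite pv.
apply/greedy_stepP; split=> //.
by apply: contra nvp => h; exact: connect_trans (h2 v pv) h.
Qed.

Lemma greedy_step_card p p' : greedy_step e p p' ->
  #|[pred x | connect e p' x]| < #|[pred x | connect e p x]|.
Proof.
case/greedy_stepP=> pp' np'p _; apply: proper_card; apply/properP; split.
  by apply/subsetP => u; rewrite !inE; apply: connect_trans; exact: connect1.
by exists p; rewrite !inE ?connect0.
Qed.

Lemma is_sink_sink b K : #|T| <= size K -> is_sink (sink V b K).
Proof.
move=> szK; apply: (@foldl_measure _ _ (fun b => #|[pred x | connect e b x]|)).
- move=> c /forallP sc; apply/forallP => x; apply: connect_trans (sc x) _.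
  by case: (next_greedyP c) => [[-> _]|[h _]]; [exact: connect0 | exact: connect1].
- move=> c /forallPn[x nxc]; apply: greedy_step_card; apply: (@greedy_step_next _ x) => //.
  by have := total x c; rewrite (negPf nxc).
- by apply: leq_trans szK; exact: max_card.
Qed.

Lemma greedy_walkP z p acc K : is_sink z -> ~~ connect e z p ->
  #|[pred x | connect e p x]| <= size K ->
  exists c, [/\ greedy_walk V z p acc K = catrev c acc, path (greedy_step e) p c,
                ~~ connect e z (last p c) & e (last p c) z].
Proof.
move=> /forallP snk; elim: K p acc => [|k K IH] p acc nzp /=.
  by rewrite leqn0 => /eqP/card0_eq/(_ p); rewrite inE connect0.
move=> le; case: (boolP (e p z)) => pz; first by exists [::].
have st := greedy_step_next (snk p) nzp.
(* If the next vertex were in the last component, domination would already give the arc from [p] to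
   [z]. *)
have nzp' : ~~ connect e z (next_greedy V p).
  have /greedy_stepP[pp' _ _] := st.
  by apply: contra pz => h; exact (in_dom isc pp' h nzp).
have [|c [h1 h2 h3 h4]] := IH (next_greedy V p) (next_greedy V p :: acc) nzp'.
  by rewrite -ltnS (leq_trans (greedy_step_card st)).
by exists (next_greedy V p :: c); rewrite /= st.
Qed.

End Greedy.
End Algorithm.

(** * Hamilton oriented cycles *)

Lemma pairmap_path (T : Type) (e : rel T) x q :
  path e x q -> count id (pairmap e x q) = size q.
Proof. by elim: q x => //= y q IH x /andP[-> /IH ->]. Qed.

Lemma count_pairmap_le (T : Type) (e : rel T) x q : count id (pairmap e x q) <= size q.
Proof. by rewrite -[X in _ <= X](size_pairmap e x); exact: count_size. Qed.

Section Digraph.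
Variable D : digraph.
Local Notation e := (@Defs.arc D).
Implicit Types (x y v s z : D) (q c R : seq D).

Lemma sigma_plus_pairmap x q : uniq (x :: q) ->
  sigma_plus (x :: q) = count id (pairmap e x (rcons q x)).
Proof.
move=> uq; rewrite /sigma_plus -[LHS](count_map _ id).
congr (count id _); apply: (@eq_from_nth _ false).
  by rewrite size_map size_pairmap size_rcons.
move=> i; rewrite size_map => lti; rewrite (nth_map x) // (nth_pairmap x) ?size_rcons //.
rewrite next_nth mem_nth // index_uniq //.
rewrite -[x :: rcons q x]/(rcons (x :: q) x) [nth x (rcons (x :: q) x) i]nth_rcons lti.
rewrite nth_rcons; congr (e _ _); case: ltngtP => //= iq; last first.
  by rewrite iq nth_default.
by move: iq lti; rewrite /= ltnS => /leq_trans h /h; rewrite ltnn.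
Qed.

Lemma sigma_plus_rot i R : uniq R -> sigma_plus (rot i R) = sigma_plus R.
Proof.
move=> uR; rewrite /sigma_plus (eq_count (a2 := fun x => e x (next R x))).
  by apply/permP; rewrite perm_rot.
by move=> x /=; rewrite next_rot.
Qed.

Lemma hamilton_uniq R : hamilton_oriented_cycle R -> uniq R.
Proof. by case/andP=> /andP[]. Qed.

Lemma hamilton_mem R x : hamilton_oriented_cycle R -> x \in R.
Proof. by case/andP=> _ /forallP. Qed.

Lemma hamilton_size R : hamilton_oriented_cycle R -> size R = #|D|.
Proof.
move=> hR; rewrite -(card_uniqP (hamilton_uniq hR)).
by apply: eq_card => x; rewrite (hamilton_mem x hR).
Qed.

Lemma sigma_plus_le_max R : hamilton_oriented_cycle R -> sigma_plus R <= sigma_hc_max D.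
Proof.
move=> hR; have sR := introT eqP (hamilton_size hR).
exact: (leq_bigmax_cond (Tuple sR) hR).
Qed.

Lemma sigma_max_le m :
  (forall R, hamilton_oriented_cycle R -> sigma_plus R <= m) -> sigma_hc_max D <= m.
Proof. by move=> h; apply/bigmax_leqP => R; exact: h. Qed.

Lemma sigma_plus_le_card R : hamilton_oriented_cycle R -> sigma_plus R <= #|D|.
Proof. by move=> hR; rewrite -(hamilton_size hR); exact: count_size. Qed.

(** Rotated to begin at [v], the cycle without [v] is a path in the underlying graph through all
    other vertices. *)
Lemma hamilton_two_connected R : 2 < #|D| -> hamilton_oriented_cycle R -> two_connected D.
Proof.
move=> n3 hR; have symadj X : symmetric (induced (@adj D) X).
  by move=> x y; rewrite /induced /adj /= [e x y || _]orbC andbCA.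
have conn_path (X : {set D}) y q : {subset y :: q <= X} -> path (@adj D) y q ->
    forall a b, a \in y :: q -> b \in y :: q -> connect (induced (@adj D) X) a b.
  move=> qX pq.
  have pX : path (induced (@adj D) X) y q.
    apply: (sub_in_path (P := mem (y :: q)) _ _ pq); last by apply/allP.
    by move=> a b /qX aX /qX bX ab; apply/and3P.
  have ya a : a \in y :: q -> connect (induced (@adj D) X) y a by exact: path_connect.
  move=> a b /ya; rewrite (sym_connect_sym (symadj X)) => h /ya; exact: connect_trans.
have cyc v : exists2 q, path (@adj D) v q & (v \notin q) && [forall x, x \in v :: q].
  have [i q E] := rot_to (hamilton_mem v hR).
  have : path (@adj D) v (rcons q v).
    by case/andP: hR => /andP[+ _] _; rewrite -(rot_cycle i) E.
  rewrite rcons_path => /andP[pq _]; exists q => //.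
  have -> : v \notin q by have := hamilton_uniq hR; rewrite -(rot_uniq i) E => /andP[].
  by rewrite /=; apply/forallP => x; rewrite -E mem_rot hamilton_mem.
apply/and3P; split=> //.
  apply/forall_inP => x _; apply/forall_inP => y _.
  have [q pq /andP[_ /forallP qall]] := cyc x.
  by apply: (conn_path _ x q) => // u _; exact: in_setT.
apply/forallP => v; apply/forall_inP => x xv; apply/forall_inP => y yv.
have [q pq /andP[nvq /forallP qall]] := cyc v.
have inq u : u \in [set~ v] -> u \in q.
  by rewrite !inE => uv; have := qall u; rewrite inE (negPf uv).
case: q pq nvq inq {qall} => [|u q]; first by move=> _ _ /(_ x xv).
move=> /= /andP[_ pq] nv inq; apply: (conn_path _ u q) => //; rewrite ?inq //.
by move=> a aq; rewrite !inE; apply: contraNneq nv => <-.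
Qed.

Section Connected.
Hypothesis conn : connected D.
Hypothesis lsc : locally_semicomplete D.

Lemma arc_osc : out_semicomplete e.
Proof.
move=> x y z xy xz yz; have /andP[/forall_inP h _] := forallP lsc x.
by have := h y; rewrite inE => /(_ xy) /forall_inP /(_ z); rewrite inE yz => /(_ xz).
Qed.

Lemma arc_isc : out_semicomplete [rel x y | e y x].
Proof.
move=> x y z yx zx yz; have /andP[_ /forall_inP h] := forallP lsc x.
by have := h y; rewrite inE => /(_ yx) /forall_inP /(_ z); rewrite inE yz orbC => /(_ zx).
Qed.

Lemma arc_total x y : connect e x y || connect e y x.
Proof.
apply: (connect_total arc_osc arc_isc) => {x y} x y.
have /forall_inP/(_ x (in_setT _))/forall_inP/(_ y (in_setT _)) := conn.
by apply: connect_sub => a b /and3P[_ _ ab]; exact: connect1.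
Qed.

Lemma strongP : reflect (forall x y, connect e x y) (strong D).
Proof.
apply: (iffP idP) => [h x y|h].
  have /forall_inP/(_ x (in_setT _))/forall_inP/(_ y (in_setT _)) := h.
  by apply: connect_sub => a b /and3P[_ _ ab]; exact: connect1.
apply/forall_inP => x _; apply/forall_inP => y _.
by rewrite (eq_connect (e' := e)) // => a b; rewrite /induced /= !in_setT.
Qed.

(** A walk from [x] to [z] in the underlying graph without [v] leaves the set of vertices reaching
    [m]. It does so along a forward arc, and domination moves the tail of this arc to [m]. *)
Lemma two_connected_skips : two_connected D -> skips_every_vertex e.
Proof.
case/and3P=> _ _ /forallP tc v m x z xv xm zv nzm.
have /forall_inP/(_ x)/[!inE]/(_ xv)/forall_inP/(_ z)/[!inE]/(_ zv) xz := tc v.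
have [a [b [/= am nbm /and3P[_ + ab] _ _]]] :=
  @connect_cross _ _ [pred u | connect e u m] x z xm nzm xz.
rewrite !inE => bv; exists b; split=> //.
case/orP: ab => ab; first exact: (out_dom arc_osc ab am nbm).
by rewrite (connect_trans (connect1 ab) am) in nbm.
Qed.

(* [c] lists the internal vertices of a shortest path from the first to the last
   strong component. *)
Definition greedy_chain s c z : Prop :=
  [/\ path (greedy_step e) s c, e (last s c) z, ~~ connect e z (last s c),
      forall x, connect e s x & forall x, connect e x z].

(** * Bounds obtained from levels *)

Section Chain.
Variables (s : D) (c : seq D) (z : D).
Hypothesis chain : greedy_chain s c z.

Lemma chain_before_sink x : x \in s :: c -> ~~ connect e z x.
Proof.
case: chain => /greedy_path pc _ nzl _ _; move/mem_split=> [l1 [l2 E]].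
apply: contra nzl => /connect_trans; apply; rewrite -[last s c]/(last s (s :: c)) E last_cat /=.
have p2 : path e x l2.
  by move: pc; case: l1 E => [|s' l1] [-> ->] //; rewrite cat_path /= => /and3P[].
by rewrite (path_connect p2 (mem_last _ _)).
Qed.

Lemma chain_after_source x : x \in c -> ~~ connect e x s.
Proof. by case: chain => pc _ _ _ _; exact: greedy_strict. Qed.

Lemma chain_uniq : uniq (s :: rcons c z).
Proof.
have ug x l : path (greedy_step e) x l -> uniq (x :: l).
  elim: l x => [//|y l IH] x pl; rewrite cons_uniq IH; last by case/andP: pl.
  by rewrite andbT; apply/negP => /(greedy_strict pl); rewrite connect0.
rewrite -rcons_cons rcons_uniq ug ?andbT; last by case: chain.
by apply/negP => /chain_before_sink; rewrite connect0.
Qed.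

Lemma level_chain_source x : connect e x s -> level e (s :: c) x = 0.
Proof. by case: chain => pc _ _ _ _; exact: level_greedy0. Qed.

Lemma level_chain_sink x : connect e z x -> level e (s :: c) x = (size c).+1.
Proof.
move=> zx; apply/eqP; rewrite -[_.+1]/(size (s :: c)) -all_count; apply/allP => p pc.
by apply: contra (chain_before_sink pc); exact: connect_trans.
Qed.

Lemma level_chain_adj x y : adj x y ->
  level e (s :: c) x + e x y <= level e (s :: c) y + 1.
Proof.
move=> xy; case: (boolP (e x y)) => [exy|nxy].
  by rewrite leq_add2r; apply: level_mono; exact: connect1.
rewrite addn0 addn1; apply: (level_step arc_osc); first by case: chain.
by move: xy; rewrite /adj /= (negPf nxy).
Qed.

(** Stated additively to avoid truncated subtraction: the level drops by at most the number of
    backward arcs, which is [size q] minus the count. *)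
Lemma level_chain_path x q : path (@adj D) x q ->
  level e (s :: c) x + count id (pairmap e x q) <= level e (s :: c) (last x q) + size q.
Proof.
have := level_chain_adj; move: (level e (s :: c)) => lv adj_lv.
elim: q x => [|y q IH] x //= /andP[/adj_lv xy /IH].
by case: (e x y) xy => /=; clear conn; lia.
Qed.

Lemma sigma_plus_chain_bound R : hamilton_oriented_cycle R ->
  sigma_plus R <= #|D| - (size c).+1.
Proof.
move=> hR; rewrite -(hamilton_size hR).
(* The cycle is cut at [z] and at [s]. From [z] to [s] the level drops from [(size c).+1] to 0; for
   the rest, its length is bound enough. *)
have [i r E] := rot_to (hamilton_mem z hR).
have uR := hamilton_uniq hR.
rewrite -(sigma_plus_rot i uR) -(size_rot i) E sigma_plus_pairmap; last by rewrite -E rot_uniq.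
have pr : path (@adj D) z (rcons r z).
  by case/andP: hR => /andP[+ _] _; rewrite -(rot_cycle i) E.
have /mem_split[r1 [r2 E2]] : s \in rcons r z.
  by rewrite mem_rcons -E mem_rot hamilton_mem.
have sz : size (z :: r) = size (rcons r1 s) + size r2.
  by rewrite /= -(size_rcons r z) E2 -cat_rcons size_cat.
rewrite sz; move: pr; rewrite E2 -cat_rcons cat_path pairmap_cat count_cat.
case/andP=> /level_chain_path; rewrite last_rcons.
rewrite (level_chain_source (connect0 e s)) (level_chain_sink (connect0 e z)) => h _.
have arith k a b d m : k + a <= d -> b <= m -> a + b <= d + m - k.
  by clear conn; lia.
exact: arith h (count_pairmap_le e s r2).
Qed.

Lemma ST_path_chain_bound (S T : {set D}) x p :
  (forall y, y \in S -> connect e y s) -> (forall y, y \in T -> connect e z y) ->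
  ST_path S T x p -> (size c).+1 <= size p.
Proof.
move=> Ss Tz /and5P[pp _ xS lT _].
have step y q : path e y q -> level e (s :: c) (last y q) <= level e (s :: c) y + size q.
  elim: q y => [|u q IH] y /=; first by rewrite addn0.
  case/andP=> yu /IH h; have /(level_step arc_osc)/(_ yu) : path (greedy_step e) s c by case: chain.
  move=> /= h2; apply: leq_trans h _; rewrite addnS -addSn leq_add2r; exact: h2.
by have := step x p pp; rewrite (level_chain_source (Ss _ xS)) (level_chain_sink (Tz _ lT)).
Qed.

End Chain.
End Connected.
End Digraph.

(** * Strong components and correctness of the algorithm *)

Section Digraph.
Variable D : digraph.
Local Notation e := (@Defs.arc D).
Implicit Types (x y v s z : D) (q c R : seq D) (Cs : seq {set D}).
Hypothesis conn : connected D.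
Hypothesis lsc : locally_semicomplete D.
Hypothesis card3 : 2 < #|D|.
Let osc := arc_osc lsc.
Let isc := arc_isc lsc.
Let total := arc_total conn lsc.

Definition component x : {set D} := [set y | connect e x y && connect e y x].

Lemma component_refl x : x \in component x.
Proof. by rewrite inE connect0. Qed.

Lemma strong_on_connect (X : {set D}) x y : strong_on X -> x \in X -> y \in X -> connect e x y.
Proof.
move=> /forall_inP h xX yX; have /forall_inP/(_ y yX) := h x xX.
by apply: connect_sub => a b /and3P[_ _ ab]; exact: connect1.
Qed.

Lemma strong_on_component x : strong_on (component x).
Proof.
apply/forall_inP => a; rewrite inE => /andP[xa ax].
apply/forall_inP => b; rewrite inE => /andP[xb bx].
have /connectP[p pp bE] : connect e a b := connect_trans ax xb.
apply/connectP; exists p => //.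
have inC u : u \in a :: p -> u \in component x.
  move=> up; have [l1 [l2 E]] := mem_split up.
  rewrite inE (connect_trans xa (path_connect pp up)) /=.
  suff ub : connect e u b by exact: connect_trans ub bx.
  apply/connectP; exists l2; last by rewrite bE -[last a p]/(last a (a :: p)) E last_cat.
  by move: pp; case: l1 E => [|a' l1] [-> ->] //; rewrite cat_path /= => /and3P[].
apply: (sub_in_path (P := mem (a :: p)) _ _ pp); last by apply/allP.
by move=> u w /inC uC /inC wC uw; apply/and3P.
Qed.

Lemma strong_componentP X :
  reflect (exists x, X = component x) (strong_component X).
Proof.
apply: (iffP idP) => [/maxsetP[sX mX]|[x ->]].
  have sub x : x \in X -> X = component x.
    move=> xX; apply/esym/mX; first exact: strong_on_component.
    by apply/subsetP => y yX; rewrite inE !(strong_on_connect sX).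
  have [X0|[x /sub ->]] := set_0Vmem X; last by exists x.
  (* The empty set is vacuously strong; as [D] has a vertex, it is not maximal. *)
  have [x _] : exists x : D, x \in predT by apply/card_gt0P; apply: leq_trans card3.
  exists x; apply/esym/mX; first exact: strong_on_component.
  by rewrite X0 sub0set.
apply/maxsetP; split; first exact: strong_on_component.
move=> B sB CB; apply/eqP; rewrite eqEsubset CB andbT; apply/subsetP => y yB.
have xB : x \in B by apply: (subsetP CB); exact: component_refl.
by rewrite inE !(strong_on_connect sB).
Qed.

(** If [s] were not in the first set, a path from [s] into that set would enter it by an arc from a
    later component, against the ordering. *)
Lemma head_ordering Cs s : acyclic_ordering Cs -> (forall x, connect e s x) ->
  head set0 Cs = [set x | connect e x s].
Proof.
move=> [_ memC pwC] src.
have inCs x : component x \in Cs by rewrite memC; apply/strong_componentP; exists x.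
case: Cs memC pwC inCs => [|C1 Cs] memC pwC inCs; first by have := inCs s.
have /strong_componentP[x C1E] : strong_component C1 by rewrite -[strong_component _]memC mem_head.
rewrite /=; suff xs : connect e x s.
  apply/setP => y; rewrite C1E !inE; apply/andP/idP => [[_ yx]|ys].
    exact: connect_trans yx xs.
  by split; [exact: connect_trans xs (src y) | exact: connect_trans ys (src x)].
apply/negPn/negP => nxs.
have [||a [b [/= Pa /negPn Pb ab _ _]]] :=
  @connect_cross _ e [pred y | y \notin C1] s x _ _ (src x).
- by rewrite /= C1E inE (negPf nxs).
- by rewrite /= negbK C1E component_refl.
case/andP: pwC => /allP pwC _.
have : component a \in C1 :: Cs by exact: inCs.
rewrite inE => /predU1P[aE|/pwC /forall_inP/(_ a (component_refl a)) /forall_inP/(_ b Pb)].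
  by rewrite -aE component_refl in Pa.
by rewrite ab.
Qed.

Lemma last_ordering Cs z : acyclic_ordering Cs -> (forall x, connect e x z) ->
  last set0 Cs = [set x | connect e z x].
Proof.
move=> [_ memC pwC] snk.
have inCs x : component x \in Cs by rewrite memC; apply/strong_componentP; exists x.
case/lastP: Cs memC pwC inCs => [|Cs C1] memC pwC inCs; first by have := inCs z.
have /strong_componentP[x C1E] : strong_component C1.
  by rewrite -[strong_component _]memC mem_rcons mem_head.
rewrite last_rcons; suff zx : connect e z x.
  apply/setP => y; rewrite C1E !inE; apply/andP/idP => [[xy _]|zy].
    exact: connect_trans zx xy.
  by split; [exact: connect_trans (snk x) zy | exact: connect_trans (snk y) zx].
apply/negPn/negP => nzx.
have [||a [b [/= Pa Pb ab _ _]]] :=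
  @connect_cross _ e [pred y | y \in C1] x z _ _ (snk x).
- by rewrite /= C1E component_refl.
- by rewrite /= C1E inE (negPf nzx) andbF.
move: pwC; rewrite pairwise_rcons => /andP[/allP pwC _].
have : component b \in rcons Cs C1 by exact: inCs.
rewrite mem_rcons inE => /predU1P[bE|].
  by rewrite -bE component_refl in Pb.
by move=> /pwC /forall_inP/(_ a Pa) /forall_inP/(_ b (component_refl b)); rewrite ab.
Qed.

Lemma chain_is_dist Cs s c z : acyclic_ordering Cs -> greedy_chain s c z ->
  is_dist (head set0 Cs) (last set0 Cs) (size c).+1.
Proof.
move=> ao ch; have [pc lz nzl src snk] := ch.
rewrite (head_ordering ao src) (last_ordering ao snk); split; last first.
  by move=> x p; apply: (ST_path_chain_bound lsc ch) => y; rewrite inE.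
exists s, (rcons c z); split; last by rewrite size_rcons.
apply/and5P; split.
- by rewrite rcons_path greedy_path.
- exact: chain_uniq ch.
- by rewrite inE connect0.
- by rewrite last_rcons inE connect0.
rewrite belast_rcons /=; apply/allP => y yc; rewrite /= !inE negb_or.
by rewrite (chain_after_source ch) // (chain_before_sink ch) // inE yc orbT.
Qed.

Lemma hamilton_of_cycle x q : path e x q -> last x q = x -> uniq q -> (forall y, y \in q) ->
  hamilton_oriented_cycle q /\ sigma_plus q = #|D|.
Proof.
move=> pq lq uq memq.
have cq : cycle e q.
  case: q pq lq {uq memq} => //= y q /andP[xy pq] lq.
  by rewrite rcons_path pq lq.
have hq : hamilton_oriented_cycle q.
  apply/andP; split; last by apply/forallP.
  apply/andP; split=> //; apply: (sub_cycle _ cq) => a b ab.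
  by rewrite /adj /= ab.
split=> //; rewrite -(hamilton_size hq); apply/eqP; rewrite -all_count; apply/allP => y yq.
exact: next_cycle cq yq.
Qed.

Lemma hamilton_of_chain s c z q : greedy_chain s c z -> path e s q -> last s q = z ->
  uniq (s :: q) -> (forall x, (x \in c) = (x \notin s :: q)) ->
  hamilton_oriented_cycle (s :: q ++ rev c) /\
  sigma_plus (s :: q ++ rev c) = #|D| - (size c).+1.
Proof.
move=> ch pq lq uq cE; have [pc lz nzl src snk] := ch.
have uR : uniq (s :: q ++ rev c).
  rewrite -cat_cons cat_uniq uq rev_uniq; have := chain_uniq ch.
  rewrite -rcons_cons rcons_uniq cons_uniq => /and3P[_ _ ->]; rewrite andbT.
  by apply/hasPn => x; rewrite mem_rev cE.
have hR : hamilton_oriented_cycle (s :: q ++ rev c).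
  apply/andP; split; last first.
    by apply/forallP => x; rewrite -cat_cons mem_cat mem_rev cE orbN.
  apply/andP; split=> //; rewrite /= rcons_cat cat_path lq; apply/andP; split.
    by apply: (sub_path _ pq) => a b ab; rewrite /adj /= ab.
  have := rev_path (@adj D) s (rcons c z); rewrite last_rcons belast_rcons rev_cons => ->.
  have : path e s (rcons c z) by rewrite rcons_path greedy_path.
  by apply: sub_path => a b ab; rewrite /adj /= ab orbT.
(* Levels give the upper estimate; the arcs of the path [q] alone attain it. *)
split=> //; apply/eqP; rewrite eqn_leq (sigma_plus_chain_bound lsc ch hR) /=.
rewrite -(hamilton_size hR) /= size_cat size_rev subSS addnK sigma_plus_pairmap //.
rewrite rcons_cat pairmap_cat count_cat -[X in X <= _](pairmap_path pq).
exact: leq_addr.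
Qed.

Lemma hamiltonP : let R := hamilton e (enum D) in
  (strong D -> hamilton_oriented_cycle R /\ sigma_plus R = #|D|) /\
  (~~ strong D -> two_connected D -> exists s c z,
     [/\ greedy_chain s c z, hamilton_oriented_cycle R
       & sigma_plus R = #|D| - (size c).+1]).
Proof.
have VT : forall x, x \in enum D by move=> x; rewrite mem_enum.
have szV : size (enum D) = #|D| by rewrite cardE.
rewrite /hamilton; move: VT szV; case: (enum D) => [|x0 V0 VT szV].
  by move=> _ n0; move: card3; rewrite -n0.
set V := x0 :: V0 in VT szV *.
set w := saturate _ _ _ [:: x0; x0] _.
have val0 : valid e [::] x0 x0 [:: x0; x0].
  by exists [:: x0]; split; [split; rewrite ?eqxx | right].
have size_unvisited F w' : size (unvisited V F w') <= size V.
  by rewrite /unvisited /remove !size_filter (leq_trans (count_size _ _)) // size_filter count_size.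
have [vw st] := saturateP VT val0 (size_unvisited _ _).
rewrite -/w in vw st.
case: vw => q [[wE lq uq _ _] pq].
have q0 : q != [::] by case: pq => [/andP[_ ->]|->].
have {}pq : path e x0 q \/ q = [:: x0] by case: pq => [/andP[? _]|?]; [left | right].
(* A starting pair that was never extended holds a single vertex and cannot cover three. *)
have covers_path : (forall x, x \in w) -> path e x0 q.
  move=> memw; case: pq => // qE; have : #|D| <= #|[set x0]|.
    apply: subset_leq_card; apply/subsetP => x _.
    by have := memw x; rewrite wE qE !inE orbb.
  by rewrite cards1 => /(leq_trans card3).
case E: (remove w V) => [|u U].
  have memw x : x \in w.
    by apply/negPn/negP => nxw; have := mem_remove w V x; rewrite E nxw VT.
  have {}pq := covers_path memw.
  have memq x : x \in q.
    have := memw x; rewrite wE inE => /predU1P[->|//].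
    by rewrite -{1}lq; case: (q) q0 => // y q' _; exact: (mem_last y q').
  have [hq sq] := hamilton_of_cycle pq lq uq memq.
  (* A closed directed path through all vertices makes [D] strong, which refutes the second case. *)
  rewrite wE /=; split=> // /strongP[] x y.
  apply: (@connect_trans _ _ x0); last first.
    by apply: (path_connect pq); rewrite -wE.
  have [l1 [l2 qE]] := mem_split (memq x); apply/connectP; exists l2.
    by move: pq; rewrite qE cat_path /= => /and3P[].
  by rewrite -lq qE last_cat.
have uw : u \notin w by have := mem_remove w V u; rewrite E mem_head => /esym/andP[].
split=> [/strongP str|nstr tc].
  have := @stuck_cycle_spans _ _ osc isc x0 q _ str lq q0 pq _ _.
  move=> /(_ (unvisited V [::] w)) U0.
  have := mem_unvisited [::] VT w u; rewrite uw U0 //.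
    by move=> v; rewrite (mem_unvisited _ VT) wE andbT.
  by rewrite -wE.
set s := source _ _ _ _; set z := sink _ _ _ _; set c' := greedy_walk _ _ _ _ _ _.
have /forallP src : is_source e s by apply: is_source_source => //; rewrite szV.
have snk' : is_sink e z by apply: is_sink_sink => //; rewrite szV.
have /forallP snk := snk'.
have nzs : ~~ connect e z s.
  apply: contra nstr => zs; apply/strongP => x y.
  exact: connect_trans (snk x) (connect_trans zs (src y)).
have [|c [c'E pc nzl lz]] := greedy_walkP VT osc isc [::] snk' nzs (K := V).
  by rewrite szV; exact: max_card.
rewrite catrevE cats0 in c'E; rewrite {}/c' c'E {c'E}.
have ch : greedy_chain s c z by [].
have sz : s != z by apply: contraNneq nzs => ->.
have val1 : valid e (rev c) s z [:: s; z].
  exists [:: z]; split; last by right.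
  split=> //; first by rewrite inE sz orbT.
  move=> x; rewrite !inE mem_rev => xsz; apply/negP => xc.
  case/orP: xsz => /eqP xE; rewrite xE in xc.
    by have := chain_after_source ch xc; rewrite connect0.
  by have := @chain_before_sink _ _ _ _ ch z; rewrite inE xc orbT connect0 => /(_ isT).
have [] := saturateP VT val1 (size_unvisited _ _).
set w2 := saturate _ _ _ _ _; case=> q2 [[w2E lq2 uq2 sq2 dis2] pq2] st2.
have UE x : (x \in unvisited V (rev c) w2) = (x \notin s :: q2) && (x \notin c).
  by rewrite (mem_unvisited _ VT) w2E mem_rev.
have zc x : connect e z x -> x \notin c.
  move=> zx; apply/negP => xc; have := @chain_before_sink _ _ _ _ ch x.
  by rewrite inE xc orbT zx => /(_ isT).
have skip := two_connected_skips lsc tc.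
have {}pq2 : path e s q2.
  (* If no ear was ever inserted, [stuck_pair_arc] supplies the arc from [s] to [z]. *)
  case: pq2 => [/andP[]//|qE]; rewrite qE /= andbT.
  rewrite w2E qE in st2.
  apply: (stuck_pair_arc osc isc total skip pc lz nzl src snk nzs zc _ st2) => x.
  by rewrite -w2E -qE -w2E in UE *; rewrite UE w2E qE.
have U0 : unvisited V (rev c) w2 = [::].
  apply: (@stuck_path_spans _ _ osc isc s z q2 _ [in c]) => //; last by rewrite -w2E.
  by move=> x xs; apply: contraTN xs => /(chain_after_source ch).
have [||hR sR] := hamilton_of_chain ch pq2 lq2.
- by rewrite /= uq2 andbT; move: sq2; rewrite (negPf sz).
- move=> x; apply/idP/idP => [xc|xq].
    by rewrite -w2E; apply/negP => /dis2; rewrite mem_rev xc.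
  by have := UE x; rewrite U0 xq in_nil /= => /esym/negbFE.
by exists s, c, z; rewrite w2E catrevE revK.
Qed.

Lemma sigma_hc_max_strong : strong D -> sigma_hc_max D = #|D|.
Proof.
move=> str; have [/(_ str)[hR sR] _] := hamiltonP.
apply/eqP; rewrite eqn_leq -{2}sR (sigma_plus_le_max hR) andbT.
exact: sigma_max_le (@sigma_plus_le_card D).
Qed.

(** A Hamilton oriented cycle forces 2-connectedness, so one of the two cases of [hamiltonP]
    applies, and its count meets the upper bound. *)
Lemma hamilton_max R0 : hamilton_oriented_cycle R0 ->
  let R := hamilton e (enum D) in
  hamilton_oriented_cycle R /\ sigma_plus R = sigma_hc_max D.
Proof.
move=> h0 R; have tc := hamilton_two_connected card3 h0.
have [hs hn] := hamiltonP; case: (boolP (strong D)) => str.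
  by have [? ->] := hs str; rewrite sigma_hc_max_strong.
have [s [c [z [ch hR sR]]]] := hn str tc; split=> //.
apply/eqP; rewrite eqn_leq (sigma_plus_le_max hR) /= [X in _ <= X]sR.
exact: sigma_max_le (sigma_plus_chain_bound lsc ch).
Qed.

Lemma sigma_hc_max_two_connected Cs : acyclic_ordering Cs ->
  ~~ strong D -> two_connected D -> exists d,
    is_dist (head set0 Cs) (last set0 Cs) d /\ sigma_hc_max D = #|D| - d.
Proof.
move=> ao nstr tc; have [_ /(_ nstr tc) [s [c [z [ch hR sR]]]]] := hamiltonP.
exists (size c).+1; split; first exact: chain_is_dist ao ch.
by have [_ <-] := hamilton_max hR.
Qed.

Lemma sigma_hc_max_not_two_connected : ~~ two_connected D -> sigma_hc_max D = 0.
Proof.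
move=> ntc; apply/eqP; rewrite -leqn0; apply: sigma_max_le => R hR.
by rewrite (hamilton_two_connected card3 hR) in ntc.
Qed.
End Digraph.

(** * The program *)

(* Programs in higher-order abstract syntax: a term is an expression depending
   on the length of its environment, and a variable is named by its position
   counted from the bottom of the environment. *)
Definition term := nat -> expr.
Definition tvar (l : nat) : term := fun d => EVar (d - l.+1).
Definition tleaf : term := fun _ => ELeaf.
Definition tnode (a b : term) : term := fun d => ENode (a d) (b d).
(** Under the two binders of the branch the left subtree is the innermost variable, hence has
    position [d.+1], and the right one has position [d]. *)
Definition tcase (a b : term) (f : term -> term -> term) : term :=
  fun d => ECase (a d) (b d) (f (tvar d.+1) (tvar d) d.+2).
Definition tlet (a : term) (f : term -> term) : term :=
  fun d => ELet (a d) (f (tvar d) d.+1).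
Definition tcall k (a : term) : term := fun d => ECall k (a d).
Definition tfun (f : term -> term) : expr := f (tvar 0) 1.
(** Every [Node] counts as true, so the test serves for booleans and for optional results, where
    [Leaf] stands for none. *)
Definition tif (c a b : term) := tcase c b (fun _ _ => a).

Notation "<< a , .. , b , c >>" := (tnode a .. (tnode b c) ..) (at level 0).

Definition dest2 (f : term -> term -> term) (u : term) := tcase u tleaf f.
Definition dest3 f := dest2 (fun x => dest2 (f x)).
Definition dest4 f := dest2 (fun x => dest3 (f x)).
Definition dest5 f := dest2 (fun x => dest4 (f x)).
Definition dest6 f := dest2 (fun x => dest5 (f x)).

Definition f_main := 0.
Definition f_nth := 1.
Definition f_eq := 2.
Definition f_mem := 3.
Definition f_remove := 4.
Definition f_arc := 5.
Definition f_find_tail := 6.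
Definition f_find_extension := 7.
Definition f_search := 8.
Definition f_catrev := 9.
Definition f_extend := 10.
Definition f_saturate := 11.
Definition f_climb := 12.
Definition f_source := 13.
Definition f_next_greedy := 14.
Definition f_sink := 15.
Definition f_greedy_walk := 16.
Definition f_iota := 17.

Definition ttrue := << tleaf, tleaf >>.

Definition t_main (M : term) : term :=
  tlet (tcall f_iota << M, tleaf >>) (fun V =>
  tcase V tleaf (fun x _ =>
  tlet (tcall f_saturate << M, V, tleaf, << x, x, tleaf >>, V >>) (fun w =>
  tcase (tcall f_remove << w, V >>) (tcase w tleaf (fun _ q => q)) (fun _ _ =>
  tlet (tcall f_source << M, V, x, V >>) (fun s =>
  tlet (tcall f_sink << M, V, s, V >>) (fun z =>
  tlet (tcall f_greedy_walk << M, V, z, s, tleaf, V >>) (fun F =>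
  tcall f_catrev
    << tcall f_catrev << tcall f_saturate << M, V, F, << s, z, tleaf >>, V >>, tleaf >>, F >>
  ))))))).

Definition t_nth := dest2 (fun l i =>
  tcase i (tcase l tleaf (fun h _ => h))
    (fun _ i' => tcase l tleaf (fun _ l' => tcall f_nth << l', i' >>))).

Definition t_eq := dest2 (fun a b =>
  tcase a (tcase b ttrue (fun _ _ => tleaf))
    (fun _ a' => tcase b tleaf (fun _ b' => tcall f_eq << a', b' >>))).

Definition t_mem := dest2 (fun v s =>
  tcase s tleaf (fun h s' =>
    tif (tcall f_eq << v, h >>) ttrue (tcall f_mem << v, s' >>))).

Definition t_remove := dest2 (fun r U =>
  tcase U tleaf (fun v U' =>
    tlet (tcall f_remove << r, U' >>) (fun U'' =>
    tif (tcall f_mem << v, r >>) U'' << v, U'' >>))).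

Definition t_arc := dest3 (fun M x y => tcall f_nth << tcall f_nth << M, x >>, y >>).

Definition t_find_tail := dest3 (fun M v L =>
  tcase L tleaf (fun pi L' =>
    tcase pi tleaf (fun h _ =>
      tif (tcall f_arc << M, h, v >>) pi (tcall f_find_tail << M, v, L' >>)))).

Definition t_find_extension := dest3 (fun M L U =>
  tcase U tleaf (fun v U' =>
    tlet (tcall f_find_tail << M, v, L >>) (fun pi =>
    tif pi << v, pi >> (tcall f_find_extension << M, L, U' >>)))).

Definition t_search := dest5 (fun M b L U K =>
  tcase K tleaf (fun _ K' =>
    tlet (tcall f_find_extension << M, L, U >>) (fun pi =>
    tcase pi tleaf (fun h _ =>
      tif (tcall f_arc << M, h, b >>) pi
        (tcall f_search
          << M, b, << pi, L >>, tcall f_remove << << h, tleaf >>, U >>, K' >>))))).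

Definition t_catrev := dest2 (fun a b =>
  tcase a b (fun h a' => tcall f_catrev << a', << h, b >> >>)).

Definition t_extend := dest4 (fun M U pre w =>
  tcase w tleaf (fun a w' =>
    tcase w' (tcall f_catrev << pre, w >>) (fun b _ =>
      tlet (tcall f_search << M, b, << << a, pre >>, tleaf >>, U, U >>) (fun pi =>
      tif pi (tcall f_catrev << pi, w' >>)
        (tcall f_extend << M, U, << a, pre >>, w' >>))))).

Definition t_saturate := dest5 (fun M V F w K =>
  tcase K w (fun _ K' =>
    tcall f_saturate << M, V, F,
      tcall f_extend
        << M, tcall f_remove << F, tcall f_remove << w, V >> >>, tleaf, w >>, K' >>)).

Definition t_climb := dest3 (fun M b l =>
  tcase l b (fun v l' =>
    tcall f_climb << M, tif (tcall f_arc << M, v, b >>) v b, l' >>)).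

Definition t_source := dest4 (fun M V b K =>
  tcase K b (fun _ K' =>
    tcall f_source << M, V, tcall f_climb << M, b, V >>, K' >>)).

Definition t_next_greedy := dest4 (fun M p b l =>
  tcase l b (fun v l' =>
    tcall f_next_greedy << M, p,
      tif (tcall f_arc << M, p, v >>) (tif (tcall f_arc << M, b, v >>) v b) b, l' >>)).

Definition t_sink := dest4 (fun M V b K =>
  tcase K b (fun _ K' =>
    tcall f_sink << M, V, tcall f_next_greedy << M, b, b, V >>, K' >>)).

Definition t_greedy_walk := dest6 (fun M V z p acc K =>
  tcase K acc (fun _ K' =>
    tif (tcall f_arc << M, p, z >>) acc
      (tlet (tcall f_next_greedy << M, p, p, V >>) (fun p' =>
       tcall f_greedy_walk << M, V, z, p', << p', acc >>, K' >>)))).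

Definition t_iota := dest2 (fun l k =>
  tcase l tleaf (fun _ l' =>
    << k, tcall f_iota << l', << tleaf, k >> >> >>)).

(** Evaluated once to plain de Bruijn expressions. The order has to agree with the numbers [f_main]
    to [f_iota]. *)
Definition prog : program := Eval vm_compute in map tfun
  [:: t_main; t_nth; t_eq; t_mem; t_remove; t_arc; t_find_tail; t_find_extension;
      t_search; t_catrev; t_extend; t_saturate; t_climb; t_source; t_next_greedy;
      t_sink; t_greedy_walk; t_iota].

(** An upper bound in place of the exact number of steps, so that costs can be rounded up to closed
    forms. *)
Definition evalb env e v b := exists2 t, eval prog env e v t & t <= b.
Definition callb k u v b := evalb [:: u] (nth ELeaf prog k) v b.

Lemma evalb_eq env e u v b b' : evalb env e u b -> u = v -> b <= b' -> evalb env e v b'.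
Proof. by case=> t ev tb <- bb'; exists t => //; exact: leq_trans bb'. Qed.

Lemma evalb_var env i v : nth Leaf env i = v -> evalb env (EVar i) v 1.
Proof. by move=> <-; exists 1 => //; exact: eval_var. Qed.

Lemma evalb_leaf env : evalb env ELeaf Leaf 1.
Proof. by exists 1 => //; exact: eval_leaf. Qed.

Lemma evalb_node env e1 e2 v1 v2 b1 b2 :
  evalb env e1 v1 b1 -> evalb env e2 v2 b2 -> evalb env (ENode e1 e2) (Node v1 v2) (b1 + b2).+1.
Proof.
by case=> t1 ? ? [t2 ? ?]; exists (t1 + t2).+1; [exact: eval_node | rewrite ltnS leq_add].
Qed.

Lemma evalb_case env e e0 e1 u v b1 b2 : evalb env e u b1 ->
  match u with
  | Leaf => evalb env e0 v b2
  | Node l r => evalb [:: l, r & env] e1 v b2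
  end -> evalb env (ECase e e0 e1) v (b1 + b2).+1.
Proof.
case=> t1 ev1 ?; case: u ev1 => [|l r] ev1 [t2 ev2 ?]; exists (t1 + t2).+1;
  rewrite ?ltnS ?leq_add //; [exact: eval_case_leaf ev1 ev2 | exact: eval_case_node ev1 ev2].
Qed.

Lemma evalb_let env e1 e2 u v b1 b2 :
  evalb env e1 u b1 -> evalb (u :: env) e2 v b2 -> evalb env (ELet e1 e2) v (b1 + b2).+1.
Proof.
case=> t1 ev1 ? [t2 ev2 ?]; exists (t1 + t2).+1; last by rewrite ltnS leq_add.
exact: eval_let ev1 ev2.
Qed.

Lemma evalb_call env k e u v b1 b2 :
  evalb env e u b1 -> callb k u v b2 -> evalb env (ECall k e) v (b1 + b2).+1.
Proof.
case=> t1 ev1 ? [t2 ev2 ?]; exists (t1 + t2).+1; last by rewrite ltnS leq_add.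
exact: eval_call ev1 ev2.
Qed.

Lemma enc_seq_nil A (enc : A -> tree) : enc_seq enc [::] = Leaf.
Proof. by []. Qed.

Lemma enc_seq_cons A (enc : A -> tree) x s : enc_seq enc (x :: s) = Node (enc x) (enc_seq enc s).
Proof. by []. Qed.

Lemma enc_nat0 : enc_nat 0 = Leaf.
Proof. by []. Qed.

Lemma enc_natS n : enc_nat n.+1 = Node Leaf (enc_nat n).
Proof. by []. Qed.

Lemma enc_true : enc_bool true = Node Leaf Leaf.
Proof. by []. Qed.

Lemma enc_false : enc_bool false = Leaf.
Proof. by []. Qed.

Definition encE := (enc_seq_nil, enc_seq_cons, enc_nat0, enc_natS, enc_true, enc_false).

Ltac ev_step tac rw :=
  lazymatch goal with
  | |- evalb _ (EVar _) _ _ => apply: evalb_var; cbn [nth]; reflexivity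
  | |- evalb _ ELeaf _ _ => exact: evalb_leaf
  | |- evalb _ (ENode _ _) _ _ => eapply evalb_node
  | |- evalb _ (ELet _ _) _ _ => eapply evalb_let
  | |- evalb _ (ECase _ _ _) _ _ => eapply evalb_case
  | |- evalb _ (ECall _ _) _ _ => eapply evalb_call
  | |- callb _ _ _ _ => tac
  | |- match _ with _ => _ end => rw; rewrite ?encE; cbv iota
  end.
(* Evaluates a function body; the calls are justified by [tac] and the
   scrutinees rewritten by [rw]. *)
Ltac run tac rw :=
  rewrite ?encE /callb; eapply evalb_eq;
  [match goal with |- evalb _ (nth ELeaf prog ?k) _ _ =>
     let body := eval vm_compute in (nth ELeaf prog k) in
     change (nth ELeaf prog k) with body end;
   repeat (ev_step tac rw)
  | try reflexivity |].

Lemma callb_le k u v b b' : callb k u v b -> b <= b' -> callb k u v b'.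
Proof. by move=> h le; exact: evalb_eq h (erefl v) le. Qed.

Lemma call_eq m n : callb f_eq (Node (enc_nat m) (enc_nat n)) (enc_bool (m == n)) (20 * m.+1).
Proof. by elim: m n => [|m IH] [|n]; run ltac:(eapply IH) idtac; lia. Qed.

Lemma call_nth A (enc : A -> tree) l i :
  callb f_nth (Node (enc_seq enc l) (enc_nat i)) (nth Leaf (map enc l) i) (20 * i.+1).
Proof. by elim: i l => [|i IH] [|x l]; run ltac:(eapply IH) idtac; rewrite ?nth_nil //; lia. Qed.

(** * Explicit cost bounds *)

Section Costs.
Variable N : nat.
(* Each of at most [N] extensions of [[:: x; y]] adds at most [N] vertices. *)
Definition walk_bound := N * N + 2.

(** In these bounds [n] is the length of the list recursed on, [n.+1] counts the calls, and the
    other factor bounds one round; [cost_extend] adds the final [catrev]. *)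
Definition cost_mem (n : nat) := n.+1 * (20 * N + 40).
Definition cost_remove (m n : nat) := n.+1 * (cost_mem m + 40).
Definition cost_find_tail n := n.+1 * (40 * N + 80).
Definition cost_find_extension m n := n.+1 * (cost_find_tail m + 60).
Definition cost_search n :=
  n.+1 * (cost_find_extension N.+1 N + cost_remove 1 N + 40 * N + 140).
Definition cost_extend m n := n.+1 * (cost_search N + 100) + 20 * (m + N).+1.
Definition cost_saturate n :=
  n.+1 * (cost_remove walk_bound N + cost_remove N N + cost_extend walk_bound walk_bound + 80).
Definition cost_climb n := n.+1 * (40 * N + 80).
Definition cost_source m n := n.+1 * (cost_climb m + 60).
Definition cost_next_greedy n := n.+1 * (80 * N + 160).
Definition cost_sink m n := n.+1 * (cost_next_greedy m + 60).
Definition cost_greedy_walk m n := n.+1 * (40 * N + cost_next_greedy m + 140).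
Definition cost_main :=
  20 * N.+1 + 2 * cost_saturate N + cost_remove walk_bound N + cost_source N N + cost_sink N N +
  cost_greedy_walk N N + 40 * walk_bound.+1 + 300.

End Costs.

(** * Correctness and cost of each function of the program *)

Section Calls.
Variable D : digraph.
Local Notation e := (@Defs.arc D).
Implicit Types (x y v a b p s z : D) (q r w U V F K pre : seq D) (L : seq (D * seq D)).
Let N := #|D|.
Let M := enc_digraph D.

Definition enc_vertex x := enc_nat (enum_rank x).
Local Notation ev := enc_vertex.
Local Notation evs := (enc_seq enc_vertex).
Definition enc_partial (pi : D * seq D) := Node (ev pi.1) (evs pi.2).
Definition enc_result (o : option (D * seq D)) := if o is Some pi then enc_partial pi else Leaf.
Local Notation eL := (enc_seq enc_partial).

Lemma call_eq_vertex x y : callb f_eq (Node (ev x) (ev y)) (enc_bool (x == y)) (20 * N).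
Proof.
have -> : (x == y) = (enum_rank x == enum_rank y :> nat).
  by rewrite (inj_eq val_inj) (inj_eq enum_rank_inj).
by apply: callb_le (call_eq _ _) _; rewrite leq_mul2l ltn_ord.
Qed.

Lemma call_arc x y : callb f_arc (Node M (Node (ev x) (ev y))) (enc_bool (e x y)) (40 * N + 20).
Proof.
have nthE A (enc : D -> A) a d : nth d (map enc (enum D)) (enum_rank a) = enc a.
  by rewrite (nth_map a) ?nth_enum_rank // -cardE ltn_ord.
have row := call_nth (fun x => enc_seq (fun y => enc_bool (e x y)) (enum D)) (enum D) (enum_rank x).
have col := call_nth (fun y => enc_bool (e x y)) (enum D) (enum_rank y).
rewrite nthE in row; rewrite nthE in col.
run ltac:(first [eapply row | eapply col]) idtac.
have := ltn_ord (enum_rank x); have := ltn_ord (enum_rank y); rewrite -/N; lia.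
Qed.

Lemma call_mem v r : callb f_mem (Node (ev v) (evs r)) (enc_bool (v \in r)) (cost_mem N (size r)).
Proof.
elim: r => [|u r IH]; first by run idtac idtac; rewrite /cost_mem; lia.
rewrite inE; case E: (v == u); have Ev := call_eq_vertex v u.
  by run ltac:(eapply Ev) ltac:(rewrite ?E); rewrite /cost_mem /=; lia.
by run ltac:(first [eapply Ev | eapply IH]) ltac:(rewrite ?E); rewrite /cost_mem /=; lia.
Qed.

Lemma call_remove r U :
  callb f_remove (Node (evs r) (evs U)) (evs (remove r U)) (cost_remove N (size r) (size U)).
Proof.
elim: U => [|v U IH]; first by run idtac idtac; rewrite /cost_remove; lia.
have Em := call_mem v r; rewrite /=; case E: (v \in r).
  by run ltac:(first [eapply IH | eapply Em]) ltac:(rewrite ?E); rewrite /cost_remove; lia.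
by run ltac:(first [eapply IH | eapply Em]) ltac:(rewrite ?E); rewrite /cost_remove; lia.
Qed.

Lemma call_find_tail v L :
  callb f_find_tail (Node M (Node (ev v) (eL L))) (enc_result (find_tail e v L))
    (cost_find_tail N (size L)).
Proof.
elim: L => [|pi L IH]; first by run idtac idtac; rewrite /cost_find_tail; lia.
rewrite encE {1}/enc_partial /=; have Ea := call_arc pi.1 v; case E: (e pi.1 v).
  by run ltac:(eapply Ea) ltac:(rewrite ?E); rewrite /cost_find_tail /=; lia.
by run ltac:(first [eapply Ea | eapply IH]) ltac:(rewrite ?E); rewrite /cost_find_tail /=; lia.
Qed.

Lemma call_find_extension L U :
  callb f_find_extension (Node M (Node (eL L) (evs U))) (enc_result (find_extension e L U))
    (cost_find_extension N (size L) (size U)).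
Proof.
elim: U => [|v U IH]; first by run idtac idtac; rewrite /cost_find_extension; lia.
have Ef := call_find_tail v L; rewrite /=; case E: (find_tail e v L) => [pi|].
  by run ltac:(eapply Ef) ltac:(rewrite ?E /=); rewrite ?E //= /cost_find_extension; lia.
by run ltac:(first [eapply Ef | eapply IH]) ltac:(rewrite ?E /=); rewrite /cost_find_extension; lia.
Qed.

Lemma size_remove r U : size (remove r U) <= size U.
Proof. by rewrite size_filter count_size. Qed.

(** Each round trades an element of [K] for one of [L], so the sum of their sizes stays constant and
    bounds the lists passed to [find_extension]. *)
Lemma call_search b L U K : size L + size K <= N.+1 -> size U <= N ->
  callb f_search (Node M (Node (ev b) (Node (eL L) (Node (evs U) (evs K)))))
    (enc_result (search e b L U K)) (cost_search N (size K)).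
Proof.
elim: K L U => [|k K IH] L U szL szU; first by run idtac idtac; rewrite /cost_search; lia.
have Ef := call_find_extension L U.
have le_f : cost_find_extension N (size L) (size U) <= cost_find_extension N N.+1 N.
  by rewrite leq_mul // leq_add2r leq_mul // ltnS; move: szL => /=; lia.
rewrite /=; case E: (find_extension e L U) => [pi|]; last first.
  by run ltac:(eapply Ef) ltac:(rewrite ?E /=); rewrite /cost_search; lia.
have Ea := call_arc pi.1 b; case E2: (e pi.1 b).
  by run ltac:(first [eapply Ef | eapply Ea]) ltac:(rewrite ?E ?E2 /=);
    rewrite ?E //= /cost_search; lia.
have Er := call_remove [:: pi.1] U.
have le_r : cost_remove N (size [:: pi.1]) (size U) <= cost_remove N 1 N.
  by rewrite leq_mul.
have {}IH := IH (pi :: L) (remove [:: pi.1] U) _ (leq_trans (size_remove _ _) szU).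
rewrite /= in IH.
run ltac:(first [eapply Ef | eapply Ea | eapply Er | eapply IH]) ltac:(rewrite ?E ?E2 /=).
  by move: szL => /=; lia.
by rewrite /cost_search; lia.
Qed.

Lemma call_catrev A (enc : A -> tree) (s1 s2 : seq A) :
  callb f_catrev (Node (enc_seq enc s1) (enc_seq enc s2)) (enc_seq enc (catrev s1 s2))
    (20 * (size s1).+1).
Proof.
elim: s1 s2 => [|x s1 IH] s2; first by run idtac idtac; lia.
by have {}IH := IH (x :: s2); run ltac:(eapply IH) idtac; rewrite /=; lia.
Qed.

Lemma call_extend U pre w m : uniq U -> size pre + size w <= m ->
  callb f_extend (Node M (Node (evs U) (Node (evs pre) (evs w))))
    (evs (extend e U pre w)) (cost_extend N m (size w)).
Proof.
move=> uU; have szU : size U <= N by rewrite -(card_uniqP uU) max_card.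
elim: w pre => [|a w IH] pre szw; first by run idtac idtac; rewrite /cost_extend; lia.
case: w IH szw => [|b w] IH szw.
  have Ec := call_catrev ev pre [:: a].
  by run ltac:(eapply Ec) idtac; move: szw; rewrite /cost_extend /=; lia.
have Es : callb f_search (Node M (Node (ev b) (Node (eL [:: (a, pre)]) (Node (evs U) (evs U)))))
    (enc_result (search e b [:: (a, pre)] U U)) (cost_search N N).
  apply: callb_le; first by apply: call_search; rewrite //= add1n ltnS.
  by rewrite leq_mul.
have := searchP e U a pre b.
rewrite [extend _ _ _ _]/=; case E: (search _ _ _ _ _) => [pi|].
  case=> r [[_ ur rU _ piE] _ _].
  have Ec := call_catrev ev (pi.1 :: pi.2) (b :: w).
  have szr : size r <= N by apply: leq_trans szU; exact: uniq_leq_size.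
  have szpi : size (pi.1 :: pi.2) <= N + m.
    by rewrite piE catrevE size_cat size_rev /=; move: szw => /=; lia.
  run ltac:(first [eapply Es | eapply Ec]) ltac:(rewrite ?E /=).
  by rewrite /cost_extend; move: szpi => /=; lia.
move=> _; have {}IH := IH (a :: pre) _.
run ltac:(first [eapply Es | eapply IH]) ltac:(rewrite ?E /=).
  by move: szw => /=; lia.
by rewrite /cost_extend /=; lia.
Qed.

Lemma size_extend U w : uniq U -> size (extend e U [::] w) <= size w + N.
Proof.
move=> uU; have [->//|w0] := eqVneq w [::].
have [[-> _]|] := @extendP _ e U [::] w w0; first exact: leq_addr.
case=> w1 [a [r [b [w2 [[wE _ ur rU] [_ ->]]]]]].
have szr : size r <= N by rewrite -(card_uniqP ur) max_card.
by rewrite wE /= !size_cat /= size_cat /=; lia.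
Qed.

Let W := walk_bound N.
(** Each of the [size K] rounds splices in at most one ear, which has at most [N] vertices. *)
Lemma size_saturate V F w K : uniq V -> size w + N * size K <= W ->
  size (saturate e V F w K) <= W.
Proof.
move=> uV; elim: K w => [|k K IH] w /=; first by rewrite muln0 addn0.
move=> sz; apply: IH; have := @size_extend (unvisited V F w) w.
by rewrite !filter_uniq // => /(_ isT); move: sz; rewrite mulnS; lia.
Qed.

Lemma call_saturate V F w K : uniq V -> size F <= N -> size w + N * size K <= W ->
  callb f_saturate (Node M (Node (evs V) (Node (evs F) (Node (evs w) (evs K)))))
    (evs (saturate e V F w K)) (cost_saturate N (size K)).
Proof.
move=> uV szF; have szV : size V <= N by rewrite -(card_uniqP uV) max_card.
elim: K w => [|k K IH] w szw; first by run idtac idtac; rewrite /cost_saturate; lia.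
have {}szw : size w + N + N * size K <= W by move: szw; rewrite /= mulnS; lia.
have cost_mono m1 m2 n1 n2 : m1 <= m2 -> n1 <= n2 -> cost_remove N m1 n1 <= cost_remove N m2 n2.
  by move=> lem len; rewrite leq_mul // leq_add2r leq_mul.
have Er1 : callb f_remove (Node (evs w) (evs V)) (evs (remove w V)) (cost_remove N W N).
  by apply: callb_le (call_remove w V) _; apply: cost_mono => //; lia.
have Er2 : callb f_remove (Node (evs F) (evs (remove w V))) (evs (unvisited V F w))
   (cost_remove N N N).
  apply: callb_le (call_remove F _) _; apply: cost_mono => //.
  exact: leq_trans (size_remove _ _) szV.
have uU : uniq (unvisited V F w) by rewrite !filter_uniq.
have Ee : callb f_extend
    (Node M (Node (evs (unvisited V F w)) (Node Leaf (evs w))))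
    (evs (extend e (unvisited V F w) [::] w)) (cost_extend N W W).
  have szw' : size w <= W by lia.
  apply: callb_le; first exact: (call_extend (pre := [::]) uU szw').
  by rewrite leq_add2r leq_mul.
have {}IH := IH (extend e (unvisited V F w) [::] w) _.
run ltac:(first [eapply Er1 | eapply Er2 | eapply Ee | eapply IH]) idtac.
  by have := size_extend w uU; lia.
by rewrite /cost_saturate -/W /=; lia.
Qed.

Lemma call_climb b l :
  callb f_climb (Node M (Node (ev b) (evs l))) (ev (climb e l b)) (cost_climb N (size l)).
Proof.
elim: l b => [|v l IH] b; first by run idtac idtac; rewrite /cost_climb; lia.
have Ea := call_arc v b; rewrite /climb /= -/(climb _ _ _).
case E: (e v b); [have {}IH := IH v | have {}IH := IH b].
  by run ltac:(first [eapply Ea | eapply IH]) ltac:(rewrite ?E); rewrite /cost_climb; lia.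
by run ltac:(first [eapply Ea | eapply IH]) ltac:(rewrite ?E); rewrite /cost_climb; lia.
Qed.

Lemma call_source V b K :
  callb f_source (Node M (Node (evs V) (Node (ev b) (evs K)))) (ev (source e V b K))
    (cost_source N (size V) (size K)).
Proof.
elim: K b => [|k K IH] b; first by run idtac idtac; rewrite /cost_source; lia.
have Ec := call_climb b V; have {}IH := IH (climb e V b).
by run ltac:(first [eapply Ec | eapply IH]) idtac; rewrite /cost_source /=; lia.
Qed.

Let next p l b := foldl (fun b v => if e p v && e b v then v else b) b l.

Lemma call_next_greedy p b l :
  callb f_next_greedy (Node M (Node (ev p) (Node (ev b) (evs l)))) (ev (next p l b))
    (cost_next_greedy N (size l)).
Proof.
elim: l b => [|v l IH] b; first by run idtac idtac; rewrite /cost_next_greedy; lia.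
have Ea := call_arc p v; have Eb := call_arc b v; rewrite /next /= -/(next p l _).
case E: (e p v); last first.
  have {}IH := IH b.
  by run ltac:(first [eapply Ea | eapply IH]) ltac:(rewrite ?E); rewrite /cost_next_greedy; lia.
rewrite /=; case E2: (e b v); [have {}IH := IH v | have {}IH := IH b].
  by run ltac:(first [eapply Ea | eapply Eb | eapply IH]) ltac:(rewrite ?E ?E2);
    rewrite /cost_next_greedy; lia.
by run ltac:(first [eapply Ea | eapply Eb | eapply IH]) ltac:(rewrite ?E ?E2);
  rewrite /cost_next_greedy; lia.
Qed.

Lemma call_sink V b K :
  callb f_sink (Node M (Node (evs V) (Node (ev b) (evs K)))) (ev (sink e V b K))
    (cost_sink N (size V) (size K)).
Proof.
elim: K b => [|k K IH] b; first by run idtac idtac; rewrite /cost_sink; lia.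
have Ec := call_next_greedy b b V; have {}IH := IH (next_greedy e V b).
by run ltac:(first [eapply Ec | eapply IH]) idtac; rewrite /cost_sink /=; lia.
Qed.

Lemma call_greedy_walk V z p acc K :
  callb f_greedy_walk
    (Node M (Node (evs V) (Node (ev z) (Node (ev p) (Node (evs acc) (evs K))))))
    (evs (greedy_walk e V z p acc K)) (cost_greedy_walk N (size V) (size K)).
Proof.
elim: K p acc => [|k K IH] p acc; first by run idtac idtac; rewrite /cost_greedy_walk; lia.
have Ea := call_arc p z; rewrite /=; case E: (e p z).
  by run ltac:(eapply Ea) ltac:(rewrite ?E); rewrite /cost_greedy_walk; lia.
have Ec := call_next_greedy p p V.
have {}IH := IH (next_greedy e V p) (next_greedy e V p :: acc).
by run ltac:(first [eapply Ea | eapply Ec | eapply IH]) ltac:(rewrite ?E);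
  rewrite /cost_greedy_walk; lia.
Qed.

Lemma size_greedy_walk V z p acc K :
  size (greedy_walk e V z p acc K) <= size acc + size K.
Proof.
elim: K p acc => [|k K IH] p acc /=; first by rewrite addn0.
by case: ifP => _; rewrite ?leq_addr // (leq_trans (IH _ _)) //= addSnnS.
Qed.

(** The rows of the adjacency matrix serve as a unary counter, from which the program obtains the
    names of the vertices. *)
Lemma call_iota A (enc : A -> tree) (l : seq A) k :
  callb f_iota (Node (enc_seq enc l) (enc_nat k)) (enc_seq enc_nat (iota k (size l)))
    (20 * (size l).+1).
Proof.
elim: l k => [|x l IH] k; first by run idtac idtac; lia.
by have {}IH := IH k.+1; run ltac:(eapply IH) idtac; rewrite /=; lia.
Qed.

Lemma enc_enum : enc_seq enc_nat (iota 0 N) = evs (enum D).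
Proof.
suff -> : iota 0 N = [seq val (enum_rank x) | x <- enum D].
  by rewrite /enc_seq foldr_map.
apply: (@eq_from_nth _ 0); first by rewrite size_map size_iota -cardE.
move=> i; rewrite size_iota => ltiN; rewrite nth_iota // add0n.
have [x0 _] : exists x : D, x \in predT by apply/card_gt0P; exact: leq_ltn_trans ltiN.
rewrite (nth_map x0) -?cardE //.
by rewrite -[X in nth _ _ X]/(val (Ordinal ltiN)) -(enum_val_nth x0) enum_valK.
Qed.

Lemma call_main : callb f_main M (evs (hamilton e (enum D))) (cost_main N).
Proof.
have szV : size (enum D) = N by rewrite -cardE.
have uV := enum_uniq D.
have Ei := call_iota (fun x => enc_seq (fun y => enc_bool (e x y)) (enum D)) (enum D) 0.
rewrite szV enc_enum -/(enc_digraph D) -/M in Ei.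
have size_F z p : size (greedy_walk e (enum D) z p [::] (enum D)) <= N.
  by apply: leq_trans (size_greedy_walk _ _ _ _ _) _; rewrite szV.
have szW x y : size [:: x; y] + N * size (enum D) <= W by rewrite szV /= /W /walk_bound addnC.
rewrite /hamilton; have := szV; have := uV; have := size_F; have := szW.
move: Ei; case: (enum D) => [|x V'] Ei.
  by move=> _ _ _ N0; run ltac:(eapply Ei) idtac; rewrite /cost_main -/W; lia.
set V := x :: V' => {}szW {}size_F {}uV {}szV.
have Es1 := @call_saturate V [::] [:: x; x] V uV isT (szW x x).
have szw1 := @size_saturate V [::] [:: x; x] V uV (szW x x).
set w := saturate e V [::] _ _ in Es1 szw1 *; rewrite szV in Es1.
have Er : callb f_remove (Node (evs w) (evs V)) (evs (remove w V)) (cost_remove N W N).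
  apply: callb_le (call_remove w V) _; rewrite szV.
  by rewrite leq_mul2l leq_add2r leq_mul2r ltnS szw1 !orbT.
case E: (remove w V) => [|u U].
  have -> : evs (behead w) = if evs w is Node _ t then t else Leaf by case: (w).
  rewrite E in Er.
  case: w Es1 Er {E szw1} => [|y w] Es1 Er.
    by run ltac:(first [eapply Ei | eapply Es1 | eapply Er]) idtac; rewrite /cost_main -/W; lia.
  by run ltac:(first [eapply Ei | eapply Es1 | eapply Er]) idtac; rewrite /cost_main -/W; lia.
rewrite E in Er.
have Eso := call_source V x V; set s := source _ _ _ _ in Eso *; rewrite szV in Eso.
have Esi := call_sink V s V; set z := sink _ _ _ _ in Esi *; rewrite szV in Esi.
have Eg := call_greedy_walk V z s [::] V; have szF := size_F z s.
set F := greedy_walk _ _ _ _ _ _ in Eg szF *; rewrite szV in Eg.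
have Es2 := @call_saturate V F [:: s; z] V uV szF (szW s z).
have szw2 := @size_saturate V F [:: s; z] V uV (szW s z).
set w2 := saturate e V F _ _ in Es2 szw2 *; rewrite szV in Es2.
have Ec1 := call_catrev ev w2 [::].
have Ec2 := call_catrev ev (catrev w2 [::]) F.
rewrite catrevE cats0 size_rev -[rev w2]cats0 -catrevE in Ec2.
run ltac:(first [eapply Ei | eapply Es1 | eapply Er | eapply Eso | eapply Esi
  | eapply Eg | eapply Es2 | eapply Ec1 | eapply Ec2]) idtac.
by rewrite /cost_main -/W; lia.
Qed.

End Calls.

(** * Polynomial bound on the running time *)

(* The bound is evaluated at an argument larger than [n] since the size of a
   digraph counts its arcs too. *)
Definition poly_bounded (f : nat -> nat) : Prop :=
  exists q : {poly nat}, forall m n, m <= n -> f m <= q.[n]%R.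

Lemma poly_bounded_const k : poly_bounded (fun => k).
Proof. by exists (k%:P)%R => m n _; rewrite hornerC. Qed.

Lemma poly_bounded_id : poly_bounded id.
Proof. by exists 'X%R => m n; rewrite hornerX. Qed.

Lemma poly_bounded_add f g :
  poly_bounded f -> poly_bounded g -> poly_bounded (fun n => f n + g n).
Proof.
move=> [p hp] [q hq]; exists (p + q)%R => m n mn; rewrite hornerD.
exact (leq_add (hp m n mn) (hq m n mn)).
Qed.

Lemma poly_bounded_mul f g :
  poly_bounded f -> poly_bounded g -> poly_bounded (fun n => f n * g n).
Proof.
move=> [p hp] [q hq]; exists (p * q)%R => m n mn; rewrite hornerM.
exact (leq_mul (hp m n mn) (hq m n mn)).
Qed.

Lemma poly_bounded_succ f : poly_bounded f -> poly_bounded (fun n => (f n).+1).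
Proof.
move=> hf; have [q hq] := poly_bounded_add hf (poly_bounded_const 1).
by exists q => m n mn; rewrite -addn1 hq.
Qed.

Lemma poly_bounded_cost_main : poly_bounded cost_main.
Proof.
rewrite /cost_main /cost_saturate /cost_extend /cost_search /cost_source /cost_climb /cost_sink.
rewrite /cost_greedy_walk /cost_next_greedy /cost_remove /cost_mem /cost_find_extension.
rewrite /cost_find_tail /walk_bound.
repeat first [ exact: poly_bounded_const | exact: poly_bounded_id
             | apply: poly_bounded_add | apply: poly_bounded_mul | apply: poly_bounded_succ ].
Qed.

Lemma runs_hamilton : exists q : {poly nat}, forall D : digraph, exists t,
  runs prog (enc_digraph D) (enc_vertices (hamilton (@Defs.arc D) (enum D))) t /\
  t <= q.[dsize D]%R.
Proof.
(* One successor pays for the call, the other for evaluating its argument. *)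
have [q hq] := poly_bounded_succ (poly_bounded_succ poly_bounded_cost_main).
exists q => D.
have var0 : evalb [:: enc_digraph D] (EVar 0) (enc_digraph D) 1 by exact: evalb_var.
have [t run_t le_t] := evalb_call var0 (call_main D).
by exists t; split; [exact: run_t | apply: leq_trans le_t (hq _ _ (leq_addr _ _))].
Qed.

Theorem theorem1p6 :
  (forall (D : digraph) (Cs : seq {set D}),
     connected D -> locally_semicomplete D -> 3 <= #|D| ->
     acyclic_ordering Cs ->
     [/\ ~~ strong D -> two_connected D ->
           exists d : nat,
             is_dist (head set0 Cs) (last set0 Cs) d /\
             sigma_hc_max D = #|D| - d,
         ~~ strong D -> ~~ two_connected D -> sigma_hc_max D = 0
       & strong D -> sigma_hc_max D = #|D|]) /\
  (exists (p : program) (q : {poly nat}),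
     forall D : digraph,
       connected D -> locally_semicomplete D -> 3 <= #|D| ->
       (exists R : seq D, hamilton_oriented_cycle R) ->
       exists (R : seq D) (t : nat),
         [/\ hamilton_oriented_cycle R,
             sigma_plus R = sigma_hc_max D,
             runs p (enc_digraph D) (enc_vertices R) t
           & t <= (q.[dsize D])%R]).
Proof.
split=> [D Cs conn lsc card3 ao|].
  split=> [nstr tc|_ ntc|str].
  - exact: sigma_hc_max_two_connected.
  - exact: sigma_hc_max_not_two_connected.
  - exact: sigma_hc_max_strong.
have [q run_q] := runs_hamilton; exists prog, q => D conn lsc card3 [R0 hR0].
have [hR sR] := hamilton_max conn lsc card3 hR0.
by have [t [run_t le_t]] := run_q D; exists (hamilton (@Defs.arc D) (enum D)), t.
Qed.
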